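(* Let $W$ be a complex vector space of dimension 6, let $e_1,\ldots,e_6$ be a basis of $W^*$, and let $\mathbb{P}(A)\subset\mathrm{Pf}\subset\mathbb{P}(\bigwedge^2W^* )$ be a stable linear space of dimension 5. Then $\mathbb{P}(A)$ is $SL(W)$-equivalent to the space $$\langle e_1\wedge e_4+e_2\wedge e_5,\ e_1\wedge e_6+e_3\wedge e_5,\ e_2\wedge e_6-e_3\wedge e_4,\ (e_1-e_5)\wedge(e_2+e_4),\ (e_1-e_5)\wedge(e_3+e_6),\ (e_2+e_4)\wedge(e_3+e_6)\rangle,$$ and $\mathbb{P}(A)$ meets the Grassmannian $\mathrm{Gr}(2,W^* )$ along a pair of disjoint planes.
   Context: The base field is $\mathbb{C}$. $\mathbb{P}(\bigwedge^2 W^* )\simeq\mathbb{P}^{14}$ is the projective space of lines in the space $\bigwedge^2W^*$ of skew-symmetric bilinear forms on $W$. The rank of a form is the (even) rank of the corresponding $6\times 6$ skew-symmetric matrix. $\mathrm{Pf}=\{\omega\in\mathbb{P}(\bigwedge^2W^* ): \mathrm{rk}(\omega)\le 4\}$ is the Pfaffian hypersurface, and $\mathrm{Gr}(2,W^* )=\{\omega: \mathrm{rk}(\omega)=2\}$ is the Plücker-embedded Grassmannian of 2-dimensional subspaces of $W^*$. An $n$-dimensional linear space (linear system of skew-symmetric forms) is $\mathbb{P}(A)\subset \mathbb{P}(\bigwedge^2W^* )$ with $A\subset\bigwedge^2W^*$ a linear subspace of dimension $n+1$. Angle brackets denote (projective) linear span. Action and stability: $g\in GL(W)$ acts on forms by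 $M_\omega\mapsto gM_\omega g^T$ on the representing skew-symmetric matrices, hence on linear subspaces; two linear spaces are $SL(W)$-equivalent if they lie in the same $SL(W)$-orbit. Let $V_{n+1}$ be a complex vector space of dimension $n+1$. Choosing an injective linear map $\phi:V_{n+1}\to\bigwedge^2W^*$ with image $A$, one regards $A$ as a vector of $V_{n+1}^*\otimes\bigwedge^2W^*$, on which $SL(W)$ acts through the second factor. $\mathbb{P}(A)$ is stable if the orbit $SL(W)\cdot A$ is closed in $V_{n+1}^*\otimes\bigwedge^2W^*$ and the stabilizer of $A$ (as a vector of this space) in $SL(W)$ is finite; this does not depend on the choice of $\phi$. *)

(* Defs.v *)
From HB Require Import structures.
From mathcomp Require Import all_boot all_order all_algebra.
From mathcomp Require Import classical_sets cardinality reals.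
From mathcomp Require Import complex ring.
From mathcomp Require Import mpoly.

Set Implicit Arguments.
Unset Strict Implicit.
Unset Printing Implicit Defensive.

Import GRing.Theory.
Local Open Scope ring_scope.

(* W^* *)
Notation dual W := 'Hom(W, GRing.regular _).

(* Bilinear forms on W, curried: w u v is the value of w at (u, v). *)
Notation bilform W := 'Hom(W, dual W).

Section Forms.
Variables (K : fieldType) (W : vectType K).
Implicit Types (a b : dual W) (w : bilform W) (g : 'End(W)).

Definition skew w := forall u v : W, w u v = - w v u.

Definition wedge_fun a b (u : W) : dual W := a u *: b - b u *: a.

Lemma wedge_fun_is_linear a b : linear (wedge_fun a b).
Proof.
move=> c u v; apply/lfunP => x; rewrite /wedge_fun !linearP !lfun_simp /=.
by rewrite /GRing.scale /=; ring.
Qed.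

HB.instance Definition _ a b :=
  GRing.isLinear.Build K W (dual W) _ (wedge_fun a b) (wedge_fun_is_linear a b).

Definition wedge a b : bilform W := linfun (wedge_fun a b).

Lemma wedgeE a b u v : wedge a b u v = a u * b v - b u * a v.
Proof. by rewrite lfunE /= /wedge_fun !lfun_simp. Qed.

(* The Gram matrix of w in a basis of W; its rank is basis independent. *)
Definition form_mx w : 'M[K]_(\dim {:W}) :=
  \matrix_(i, j) w (vbasis {:W})`_i (vbasis {:W})`_j.

Definition form_rank w : nat := \rank (form_mx w).

(* Subsets of P(/\^2 W^* ) are given by the nonzero vectors of their cones. *)
Definition in_Pf w := [/\ w != 0, skew w & (form_rank w <= 4)%N].
Definition in_Gr w := [/\ w != 0, skew w & form_rank w = 2%N].

Definition lfun_det g : K := \det (passmx.mxof (vbasis {:W}) (vbasis {:W}) g).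

Definition SL : set 'End(W) := [set g | lfun_det g = 1]%classic.

(* The action of GL(W) on forms, (g . w)(u, v) = w (g^-1 u) (g^-1 v). If h is *)
(* the matrix of the contragredient action of g on W^*, then on matrices of   *)
(* forms this is M |-> h M h^T.                                               *)
Definition act_fun g w (u : W) : dual W := (w (g^-1%VF u) \o g^-1)%VF.

Lemma act_fun_is_linear g w : linear (act_fun g w).
Proof.
by move=> c u v; apply/lfunP => x; rewrite /act_fun !linearP /= !lfun_simp.
Qed.

HB.instance Definition _ g w :=
  GRing.isLinear.Build K W (dual W) _ (act_fun g w) (act_fun_is_linear g w).

Definition act g w : bilform W := linfun (act_fun g w).

Lemma actE g w u v : act g w u v = w (g^-1%VF u) (g^-1%VF v).
Proof. by rewrite lfunE /= /act_fun !lfun_simp. Qed.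

Lemma act_is_linear g : linear (act g).
Proof.
move=> c w1 w2; apply/lfunP => u; apply/lfunP => v.
by rewrite !(add_lfunE, scale_lfunE, actE).
Qed.

HB.instance Definition _ g :=
  GRing.isLinear.Build K (bilform W) (bilform W) _ (act g) (act_is_linear g).

Definition SL_equiv (A B : {vspace bilform W}) :=
  exists2 g, SL g & B = (linfun (act g) @: A)%VS.

End Forms.

Section Zariski.
Variables (K : fieldType) (U : vectType K).

Definition zariski_closed (X : set U) :=
  exists S : set {mpoly K[\dim {:U}]},
    X = [set x | forall p, S p ->
                   p.@[fun i => coord (vbasis {:U}) i x] = 0]%classic.

End Zariski.

Section Stability.
Variables (K : fieldType) (W : vectType K).

(* SL(W) acts on V^* (x) /\^2 W^* through the second factor. This space is    *)
(* the linear subspace of 'Hom(V, bilform W) of the maps with skew values, so *)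
(* being closed in the one or in the other is the same for its subsets.       *)
Definition SL_orbit (V : vectType K) (phi : 'Hom(V, bilform W)) :
    set 'Hom(V, bilform W) :=
  [set psi | exists2 g, SL g & psi = (linfun (act g) \o phi)%VF]%classic.

Definition SL_stabilizer (V : vectType K) (phi : 'Hom(V, bilform W)) :
    set 'End(W) :=
  [set g | SL g /\ (linfun (act g) \o phi)%VF = phi]%classic.

(* phi ranges over the parametrizations 'rV_(\dim A) -> A; the last two       *)
(* conditions do not depend on the choice of phi.                             *)
Definition stable (A : {vspace bilform W}) :=
  exists phi : 'Hom('rV[K]_(\dim A), bilform W),
    [/\ lker phi = 0%VS, limg phi = A,
        zariski_closed (SL_orbit phi) & finite_set (SL_stabilizer phi)].

End Stability.

(* Main.v *)
From HB Require Import structures.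
From mathcomp Require Import all_boot all_order all_algebra.
From mathcomp Require Import boolp classical_sets cardinality reals.
From mathcomp Require Import complex ring.
From mathcomp Require Import mpoly zify.
Require Import Defs.

(* If A is stable, then (S3) no 3-dimensional subspace of W is isotropic for
   all forms of A, and (S1) no vector u of W is orthogonal, for all forms of A,
   to a hyperplane containing u: otherwise a one-parameter subgroup with
   weights (-1,-1,-1,1,1,1), resp. (-1,0,0,0,0,1), has a limit on A, which lies
   in the closed orbit and has infinite stabilizer.

   Polarizing the Pfaffian at a form w of rank 4 in A shows that A maps to an
   isotropic subspace of Hom(ker w, (W / ker w)^* ), of dimension at most 4, so
   a pencil in A has the same kernel as w and contains a form p = a /\ b of
   rank 2. Polarizing at p, the restrictions of A to the 4-space
   U = {a = b = 0} are all degenerate; by (S3) there is a line l in U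
   orthogonal to U for A, and the restrictions fill /\^2 (U / l)^*. In a basis
   (a, b, c, t3, t4, t5) of W^* with l dual to c, an element of A is
     lam a/\c + mu b/\c + nu a/\b + a/\x + b/\y + tau,   x, y in <t3,t4,t5>,
   with tau in /\^2 <t3,t4,t5>, and its Pfaffian is <tau, mu x - lam y> = 0.
   By (S1) and (S3) this forces (lam, mu, nu, tau) to be coordinates on A, and
   then x, y are removed by shearing c, t3, t4, t5. Hence
   A = /\^2 <a,b,c> + /\^2 <t3,t4,t5>, and the space of the statement has the
   same shape. *)

Set Implicit Arguments.
Unset Strict Implicit.
Unset Printing Implicit Defensive.

Import Order.TTheory GRing.Theory Num.Theory.
Local Open Scope ring_scope.

(** * Evaluation of forms and dual pairs of bases *)

Section Evaluation.
Variables (K : fieldType) (W : vectType K).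
Implicit Types (a b : dual W) (w : bilform W) (u v : W) (c : K).

(** [ap] and [ev] restate application with values in [K] itself rather than in the regular module,
    the carrier on which [ring] and [field] are to work. *)
Definition ap a u : K := a u.
Definition ev w u v : K := w u v.

Lemma apD a u v : ap a (u + v) = ap a u + ap a v.
Proof. by rewrite /ap linearD. Qed.

Lemma apZ a c u : ap a (c *: u) = c * ap a u.
Proof. by rewrite /ap linearZ. Qed.

Lemma ap0 a : ap a 0 = 0.
Proof. by rewrite /ap linear0. Qed.

Lemma ap_sum (I : Type) (r : seq I) (P : pred I) (F : I -> W) a :
  ap a (\sum_(i <- r | P i) F i) = \sum_(i <- r | P i) ap a (F i).
Proof. by rewrite /ap linear_sum. Qed.

Lemma apDf a b u : ap (a + b) u = ap a u + ap b u.
Proof. by rewrite /ap add_lfunE. Qed.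

Lemma apNf a u : ap (- a) u = - ap a u.
Proof. by rewrite /ap opp_lfunE. Qed.

Lemma apZf a c u : ap (c *: a) u = c * ap a u.
Proof. by rewrite /ap scale_lfunE. Qed.

Lemma ap0f u : ap 0 u = 0.
Proof. by rewrite /ap zero_lfunE. Qed.

Lemma ap_sumf (I : Type) (r : seq I) (P : pred I) (F : I -> dual W) u :
  ap (\sum_(i <- r | P i) F i) u = \sum_(i <- r | P i) ap (F i) u.
Proof. by rewrite /ap sum_lfunE. Qed.

Lemma evZl w c u v : ev w (c *: u) v = c * ev w u v.
Proof. by rewrite /ev linearZ scale_lfunE. Qed.

Lemma evZr w c u v : ev w u (c *: v) = c * ev w u v.
Proof. by rewrite /ev linearZ. Qed.

Lemma evDf w1 w2 u v : ev (w1 + w2) u v = ev w1 u v + ev w2 u v.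
Proof. by rewrite /ev !add_lfunE. Qed.

Lemma evZf c w u v : ev (c *: w) u v = c * ev w u v.
Proof. by rewrite /ev !scale_lfunE. Qed.

Lemma evNf w u v : ev (- w) u v = - ev w u v.
Proof. by rewrite -scaleN1r evZf mulN1r. Qed.

Lemma ev0f u v : ev 0 u v = 0.
Proof. by rewrite /ev !zero_lfunE. Qed.

Lemma ev_suml (I : Type) (r : seq I) (P : pred I) (F : I -> W) w v :
  ev w (\sum_(i <- r | P i) F i) v = \sum_(i <- r | P i) ev w (F i) v.
Proof. by rewrite /ev linear_sum sum_lfunE. Qed.

Lemma ev_sumr (I : Type) (r : seq I) (P : pred I) (F : I -> W) w u :
  ev w u (\sum_(i <- r | P i) F i) = \sum_(i <- r | P i) ev w u (F i).
Proof. by rewrite /ev linear_sum. Qed.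

Lemma ev_sumf (I : Type) (r : seq I) (P : pred I) (F : I -> bilform W) u v :
  ev (\sum_(i <- r | P i) F i) u v = \sum_(i <- r | P i) ev (F i) u v.
Proof. by rewrite /ev !sum_lfunE. Qed.

Lemma ev_wedge a b u v : ev (wedge a b) u v = ap a u * ap b v - ap b u * ap a v.
Proof. exact: wedgeE. Qed.

Lemma bilformP w1 w2 : (forall u v, ev w1 u v = ev w2 u v) -> w1 = w2.
Proof. by move=> e; apply/lfunP => u; apply/lfunP => v; apply: e. Qed.

End Evaluation.

Section DualPairs.
Variables (K : fieldType) (W : vectType K).

Definition dual_pair n (f : nat -> W) (x : nat -> dual W) :=
  forall i j, (i < n)%N -> (j < n)%N -> ap (x i) (f j) = (i == j)%:R.

Lemma dual_pair_sum n f x (c : 'I_n -> K) (j : 'I_n) : dual_pair n f x ->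
  ap (x j) (\sum_i c i *: f i) = c j.
Proof.
move=> fx; rewrite ap_sum (bigD1 j) //= apZ fx // eqxx mulr1 big1 ?addr0 //.
move=> i ne_ij; rewrite apZ fx // (_ : (_ == _) = false) ?mulr0 //.
by rewrite eq_sym; apply: negbTE.
Qed.

Lemma dual_pair_free n f x : dual_pair n f x -> free (mkseq f n).
Proof.
move=> fx; have sz : size (mkseq f n) == n by rewrite size_mkseq.
rewrite -[mkseq f n]/(tval (Tuple sz)); apply/freeP => k k0 j; rewrite -(dual_pair_sum k j fx).
rewrite (_ : \sum_i _ = 0) ?ap0 //; apply: etrans k0.
by apply: eq_bigr => i _; rewrite nth_mkseq.
Qed.

Lemma dual_pair_decomp n f x (dimW : \dim {:W} = n) : dual_pair n f x ->
  forall v, v = \sum_(i < n) ap (x i) v *: f i.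
Proof.
move=> fx v; have sz : size (mkseq f n) == n by rewrite size_mkseq.
pose t := Tuple sz.
have /coord_basis -/(_ v (memvf v)) : basis_of fullv t.
  by rewrite basisEfree (dual_pair_free fx) subvf dimW /= size_mkseq leqnn.
set c := fun i => coord t i v => vE.
have {}vE : v = \sum_(i < n) c i *: f i.
  by rewrite {1}vE; apply: eq_bigr => i _; rewrite nth_mkseq.
by rewrite {1}vE; apply: eq_bigr => i _; rewrite vE (dual_pair_sum _ _ fx).
Qed.

Lemma dual_pair_bilformP n f x w1 w2 (dimW : \dim {:W} = n) :
  dual_pair n f x ->
  (forall i j, (i < n)%N -> (j < n)%N ->
     ev w1 (f i) (f j) = ev w2 (f i) (f j)) -> w1 = w2.
Proof.
move=> fx e; apply: bilformP => u v.
rewrite (dual_pair_decomp dimW fx u) (dual_pair_decomp dimW fx v).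
rewrite !ev_suml; apply: eq_bigr => i _; rewrite !ev_sumr; apply: eq_bigr => j _.
by rewrite !evZl !evZr e.
Qed.

(** The functionals are the coordinates along [s], with 0 for indices beyond [size s]. *)
Lemma free_dual (s : seq W) :
  free s -> exists x, dual_pair (size s) (nth 0 s) x.
Proof.
move=> fs; pose t := in_tuple s.
exists (fun i => if insub i is Some j then linfun (coord t j : W -> K^o) else 0).
move=> i j li lj; rewrite insubT /ap lfunE /=.
by rewrite (coord_free (X := t) (Ordinal lj) (Ordinal li) fs) /= eq_sym.
Qed.

Lemma free_extend (s : seq W) :
  free s -> exists s', basis_of fullv (s ++ s').
Proof.
move=> fs; exists (vbasis (<<s>>^C)%VS); rewrite basisEfree; apply/and3P; split.
- rewrite cat_free fs (basis_free (vbasisP _)) (span_basis (vbasisP _)) /=.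
  by apply/directv_addP; rewrite capv_compl.
- exact: subvf.
rewrite size_cat size_tuple dimv_compl.
by rewrite -(eqP fs) subnKC // dimvS // subvf.
Qed.

Definition ap_row n (g : 'I_n -> dual W) (v : W) := \row_i ap (g i) v.

Lemma ap_row_is_linear n (g : 'I_n -> dual W) : linear (ap_row g).
Proof. by move=> c u v; apply/rowP => i; rewrite !mxE apD apZ. Qed.

HB.instance Definition _ n (g : 'I_n -> dual W) :=
  GRing.isLinear.Build K W 'rV[K]_n _ (ap_row g) (ap_row_is_linear g).

Lemma ker_free (gs : seq (dual W)) n : (n + size gs <= \dim {:W})%N ->
  exists s : seq W, [/\ size s = n, free s &
    forall g v, g \in gs -> v \in s -> ap g v = 0].
Proof.
move=> le_n; pose U := lker (linfun (ap_row (fun i : 'I_(size gs) => gs`_i))).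
have dimU : (n <= \dim U)%N.
  have := limg_ker_dim (linfun (ap_row (fun i : 'I_(size gs) => gs`_i))) fullv; rewrite capfv -/U => dU.
  have := dimvS (subvf (limg (linfun (ap_row (fun i : 'I_(size gs) => gs`_i))))).
  rewrite dimvf /dim /= mul1n => le_gs; rewrite -(leq_add2r (size gs)).
  by apply: leq_trans le_n _; rewrite -dU leq_add2l.
exists (take n (vbasis U)); split.
- by rewrite size_takel // size_tuple.
- have := basis_free (vbasisP U).
  by rewrite -{1}(cat_take_drop n (vbasis U)); apply: catl_free.
move=> g v gs_g /mem_take /vbasis_mem; rewrite memv_ker lfunE /= => /eqP /rowP.
by move/(_ (Ordinal (etrans (index_mem g gs) gs_g))); rewrite !mxE /= nth_index.
Qed.

(** The new vectors are taken in the common kernel of the given functionals, which therefore stay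
    unchanged. If these are read off from a form, the new vectors are orthogonal to the old ones. *)
Lemma dual_pair_complete n m f x (dimW : \dim {:W} = (n + m)%N) :
  dual_pair n f x ->
  exists f' x', [/\ dual_pair (n + m) f' x',
    (forall i, (i < n)%N -> f' i = f i) & (forall i, (i < n)%N -> x' i = x i)].
Proof.
move=> fx; have [|s [sz_s fr_s s0]] := @ker_free (mkseq x n) m.
  by rewrite size_mkseq dimW addnC.
have {}s0 i v : (i < n)%N -> v \in s -> ap (x i) v = 0.
  by move=> li; apply: s0; apply/mapP; exists i; rewrite ?mem_iota.
pose t := mkseq f n ++ s.
have sz_t : size t = (n + m)%N by rewrite size_cat size_mkseq sz_s.
have fr_t : free t.
  rewrite cat_free (dual_pair_free fx) fr_s /=; apply/directv_addP.
  apply/eqP; rewrite -subv0; apply/subvP => v; rewrite memv_cap memv0.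
  move=> /andP [v1 v2].
  have vx i : (i < n)%N -> ap (x i) v = 0.
    move=> li; have sz : size s == m by rewrite sz_s.
    rewrite (coord_span (X := Tuple sz) v2) ap_sum big1 // => j _.
    by rewrite apZ s0 ?mulr0 // mem_nth // sz_s.
  have sz : size (mkseq f n) == n by rewrite size_mkseq.
  pose c i := coord (Tuple sz) i v.
  have vE : v = \sum_(i < n) c i *: f i.
    rewrite {1}(coord_span (X := Tuple sz) v1); apply: eq_bigr => i _.
    by rewrite nth_mkseq.
  rewrite vE big1 // => i _; rewrite -(dual_pair_sum c i fx) -vE.
  by rewrite vx ?scale0r.
have [y] := free_dual fr_t; rewrite sz_t => ty.
exists (nth 0 t), (fun i => if (i < n)%N then x i else y i); split.
- move=> i j li lj; case: ifP => lin; last exact: ty.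
  rewrite nth_cat size_mkseq; case: ifP => ljn.
    by rewrite nth_mkseq // fx.
  rewrite s0 ?mem_nth ?sz_s //; last by lia.
  by case: eqP => // ij; move: lin; rewrite ij ljn.
- by move=> i li; rewrite nth_cat size_mkseq li nth_mkseq.
- by move=> i ->.
Qed.

End DualPairs.

(** * Pfaffians *)

(** Adds [c] times a known equation to the goal; chained calls reduce the goal to an identity for
    [ring], the constants [c] being the certificate. *)
Lemma addcomb (R : pzRingType) (c l r a b : R) :
  l = r -> a + c * l = b + c * r -> a = b.
Proof. by move=> -> /addIr. Qed.

Section Pfaffians.
Variable K : idomainType.
Implicit Types k : nat -> K.
Variable e : nat -> nat -> K.
Local Notation E i j := (e i%N j%N).

Definition pf4 : K := E 0 1 * E 2 3 - E 0 2 * E 1 3 + E 0 3 * E 1 2.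

Definition pf6 : K :=
    E 0 1 * (E 2 3 * E 4 5 - E 2 4 * E 3 5 + E 2 5 * E 3 4)
  - E 0 2 * (E 1 3 * E 4 5 - E 1 4 * E 3 5 + E 1 5 * E 3 4)
  + E 0 3 * (E 1 2 * E 4 5 - E 1 4 * E 2 5 + E 1 5 * E 2 4)
  - E 0 4 * (E 1 2 * E 3 5 - E 1 3 * E 2 5 + E 1 5 * E 2 3)
  + E 0 5 * (E 1 2 * E 3 4 - E 1 3 * E 2 4 + E 1 4 * E 2 3).

Definition alternating := (forall i, e i i = 0) /\ forall i j, e j i = - e i j.

(* Multiplied by [k i], the Pfaffian is a combination of the entries of the   *)
(* row [k * e], with the cofactors of row [i] as coefficients.                *)
Lemma pf4_ker k i : alternating -> (i < 4)%N -> k i != 0 ->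
  (forall j, \sum_(l < 4) k l * e l j = 0) -> pf4 = 0.
Proof.
move=> [e0 eN] li ki ke.
have r j : k 0%N * e 0 j + k 1%N * e 1 j + k 2%N * e 2 j + k 3%N * e 3 j = 0.
  by rewrite -[RHS](ke j) !big_ord_recr big_ord0 /= add0r.
apply: (mulfI ki); rewrite mulr0 /pf4.
have := (r 0%N, r 1%N, r 2%N, r 3%N); rewrite !e0 ?[E 1 0]eN ?[E 2 0]eN ?[E 3 0]eN.
rewrite ?[E 2 1]eN ?[E 3 1]eN ?[E 3 2]eN => -[[[r0 r1] r2] r3].
do 4?[case: i li ki => [|i] li ki] => //.
- apply: (addcomb (c := - E 2 3) r1); apply: (addcomb (c := E 1 3) r2).
  by apply: (addcomb (c := - E 1 2) r3); ring.
- apply: (addcomb (c := E 2 3) r0); apply: (addcomb (c := - E 0 3) r2).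
  by apply: (addcomb (c := E 0 2) r3); ring.
- apply: (addcomb (c := - E 1 3) r0); apply: (addcomb (c := E 0 3) r1).
  by apply: (addcomb (c := - E 0 1) r3); ring.
- apply: (addcomb (c := E 1 2) r0); apply: (addcomb (c := - E 0 2) r1).
  by apply: (addcomb (c := E 0 1) r2); ring.
Qed.

Lemma pf6_ker k i : alternating -> (i < 6)%N -> k i != 0 ->
  (forall j, \sum_(l < 6) k l * e l j = 0) -> pf6 = 0.
Proof.
move=> [e0 eN] li ki ke.
have r j : k 0%N * e 0 j + k 1%N * e 1 j + k 2%N * e 2 j + k 3%N * e 3 j + k 4%N * e 4 j
    + k 5%N * e 5 j = 0.
  by rewrite -[RHS](ke j) !big_ord_recr big_ord0 /= add0r.
apply: (mulfI ki); rewrite mulr0 /pf6.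
have := (r 0%N, r 1%N, r 2%N, r 3%N, r 4%N, r 5%N); rewrite !e0.
rewrite ?[E 1 0]eN ?[E 2 0]eN ?[E 3 0]eN ?[E 4 0]eN ?[E 5 0]eN.
rewrite ?[E 2 1]eN ?[E 3 1]eN ?[E 4 1]eN ?[E 5 1]eN ?[E 3 2]eN ?[E 4 2]eN.
rewrite ?[E 5 2]eN ?[E 4 3]eN ?[E 5 3]eN ?[E 5 4]eN => -[[[[[r0 r1] r2] r3] r4] r5].
do 6?[case: i li ki => [|i] li ki] => //.
- apply: (addcomb (c := - (E 2 3 * E 4 5 - E 2 4 * E 3 5 + E 2 5 * E 3 4)) r1).
  apply: (addcomb (c := (E 1 3 * E 4 5 - E 1 4 * E 3 5 + E 1 5 * E 3 4)) r2).
  apply: (addcomb (c := - (E 1 2 * E 4 5 - E 1 4 * E 2 5 + E 1 5 * E 2 4)) r3).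
  apply: (addcomb (c := (E 1 2 * E 3 5 - E 1 3 * E 2 5 + E 1 5 * E 2 3)) r4).
  by apply: (addcomb (c := - (E 1 2 * E 3 4 - E 1 3 * E 2 4 + E 1 4 * E 2 3)) r5); ring.
- apply: (addcomb (c := (E 2 3 * E 4 5 - E 2 4 * E 3 5 + E 2 5 * E 3 4)) r0).
  apply: (addcomb (c := - (E 0 3 * E 4 5 - E 0 4 * E 3 5 + E 0 5 * E 3 4)) r2).
  apply: (addcomb (c := (E 0 2 * E 4 5 - E 0 4 * E 2 5 + E 0 5 * E 2 4)) r3).
  apply: (addcomb (c := - (E 0 2 * E 3 5 - E 0 3 * E 2 5 + E 0 5 * E 2 3)) r4).
  by apply: (addcomb (c := (E 0 2 * E 3 4 - E 0 3 * E 2 4 + E 0 4 * E 2 3)) r5); ring.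
- apply: (addcomb (c := - (E 1 3 * E 4 5 - E 1 4 * E 3 5 + E 1 5 * E 3 4)) r0).
  apply: (addcomb (c := (E 0 3 * E 4 5 - E 0 4 * E 3 5 + E 0 5 * E 3 4)) r1).
  apply: (addcomb (c := - (E 0 1 * E 4 5 - E 0 4 * E 1 5 + E 0 5 * E 1 4)) r3).
  apply: (addcomb (c := (E 0 1 * E 3 5 - E 0 3 * E 1 5 + E 0 5 * E 1 3)) r4).
  by apply: (addcomb (c := - (E 0 1 * E 3 4 - E 0 3 * E 1 4 + E 0 4 * E 1 3)) r5); ring.
- apply: (addcomb (c := (E 1 2 * E 4 5 - E 1 4 * E 2 5 + E 1 5 * E 2 4)) r0).
  apply: (addcomb (c := - (E 0 2 * E 4 5 - E 0 4 * E 2 5 + E 0 5 * E 2 4)) r1).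
  apply: (addcomb (c := (E 0 1 * E 4 5 - E 0 4 * E 1 5 + E 0 5 * E 1 4)) r2).
  apply: (addcomb (c := - (E 0 1 * E 2 5 - E 0 2 * E 1 5 + E 0 5 * E 1 2)) r4).
  by apply: (addcomb (c := (E 0 1 * E 2 4 - E 0 2 * E 1 4 + E 0 4 * E 1 2)) r5); ring.
- apply: (addcomb (c := - (E 1 2 * E 3 5 - E 1 3 * E 2 5 + E 1 5 * E 2 3)) r0).
  apply: (addcomb (c := (E 0 2 * E 3 5 - E 0 3 * E 2 5 + E 0 5 * E 2 3)) r1).
  apply: (addcomb (c := - (E 0 1 * E 3 5 - E 0 3 * E 1 5 + E 0 5 * E 1 3)) r2).
  apply: (addcomb (c := (E 0 1 * E 2 5 - E 0 2 * E 1 5 + E 0 5 * E 1 2)) r3).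
  by apply: (addcomb (c := - (E 0 1 * E 2 3 - E 0 2 * E 1 3 + E 0 3 * E 1 2)) r5); ring.
- apply: (addcomb (c := (E 1 2 * E 3 4 - E 1 3 * E 2 4 + E 1 4 * E 2 3)) r0).
  apply: (addcomb (c := - (E 0 2 * E 3 4 - E 0 3 * E 2 4 + E 0 4 * E 2 3)) r1).
  apply: (addcomb (c := (E 0 1 * E 3 4 - E 0 3 * E 1 4 + E 0 4 * E 1 3)) r2).
  apply: (addcomb (c := - (E 0 1 * E 2 4 - E 0 2 * E 1 4 + E 0 4 * E 1 2)) r3).
  by apply: (addcomb (c := (E 0 1 * E 2 3 - E 0 2 * E 1 3 + E 0 3 * E 1 2)) r4); ring.
Qed.

End Pfaffians.

(** * Rank and Gram matrices of skew forms *)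

Section FormRank.
Variables (K : fieldType) (W : vectType K).
Hypothesis two_neq0 : 2 != 0 :> K.
Implicit Types (a b : dual W) (w : bilform W) (u v : W) (f : nat -> W).

Definition gram w f i j := ev w (f i) (f j).

Lemma skewP w : skew w -> forall u v, ev w v u = - ev w u v.
Proof. by move=> sk u v; rewrite /ev sk. Qed.

Lemma skew_diag w u : skew w -> ev w u u = 0.
Proof.
move=> sk; have /eqP := skewP sk u u.
by rewrite -addr_eq0 -mulr2n -mulr_natl mulf_eq0 (negPf two_neq0) => /eqP.
Qed.

Lemma gram_alternating w f : skew w -> alternating (gram w f).
Proof. by move=> sk; split=> [i|i j]; [apply: skew_diag | apply: skewP]. Qed.

Lemma skew_wedge a b : skew (wedge a b).
Proof. by move=> u v; rewrite !wedgeE /=; ring. Qed.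

Lemma skew0 : skew (0 : bilform W).
Proof. by move=> u v; rewrite -!/(ev _ _ _) !ev0f oppr0. Qed.

(** The coordinate matrix of [f] times the Gram matrix has rank below [n], so its rows satisfy a
    nontrivial relation [k]. *)
Lemma gram_ker w n f : (form_rank w < n)%N ->
  exists k i, [/\ (i < n)%N, k i != 0 &
    forall v, \sum_(l < n) k l * ev w (f l) v = 0].
Proof.
pose X : 'M[K]_(n, \dim {:W}) := \matrix_(i, j) coord (vbasis {:W}) j (f i).
have XE i j : (X *m form_mx w) i j = ev w (f i) (vbasis {:W})`_j.
  rewrite mxE [f i in RHS](coord_vbasis (memvf _)) ev_suml.
  by apply: eq_bigr => l _; rewrite !mxE evZl.
move=> rk_w; have : kermx (X *m form_mx w) != 0.
  rewrite -mxrank_eq0 mxrank_ker subn_eq0 -ltnNge.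
  by apply: leq_ltn_trans rk_w; apply: mxrankM_maxr.
case/rowV0Pn => c /sub_kermxP c0 /rV0Pn [i ci].
exists (fun l => if insub l is Some j then c 0 j else 0), i; split => //.
  by rewrite valK.
move=> v; rewrite [v](coord_vbasis (memvf _)).
under eq_bigr do rewrite valK ev_sumr mulr_sumr; rewrite exchange_big /=.
apply: big1 => j _; move/rowP/(_ j): c0; rewrite !mxE => c0.
under eq_bigr do rewrite evZr mulrCA; rewrite -mulr_sumr.
rewrite (_ : \sum_l _ = 0) ?mulr0 //; apply: etrans c0.
by apply: eq_bigr => l _; rewrite XE.
Qed.

Lemma bilform_neq0 w : w != 0 -> exists u v, ev w u v != 0.
Proof.
move=> /eqP w0; apply: contrapT => nw; apply: w0; apply: bilformP => u v.
by rewrite ev0f; apply/eqP; apply: contrapT => /negP ne; apply: nw; exists u, v.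
Qed.

Lemma skew_rank_ge2 w : skew w -> w != 0 -> (2 <= form_rank w)%N.
Proof.
move=> sk /bilform_neq0 [u [v uv]]; rewrite leqNgt; apply/negP.
move=> /(@gram_ker w 2 (nth 0 [:: u; v])) [k [i [li ki ke]]].
have ku := ke u; have kv := ke v; move: ku kv.
rewrite !big_ord_recr !big_ord0 /= !skew_diag // !mulr0 !(add0r, addr0).
rewrite (skewP sk u v) => /eqP; rewrite mulf_eq0 oppr_eq0 (negPf uv) orbF => k1.
move=> /eqP; rewrite mulf_eq0 (negPf uv) orbF => k0.
by case: i li ki => [|[|i]] // _; rewrite ?k0 ?k1.
Qed.

Lemma rank_pf4 w f : skew w -> (form_rank w < 4)%N -> pf4 (gram w f) = 0.
Proof.
move=> sk /(@gram_ker _ _ f) [k [i [li ki ke]]].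
exact: (pf4_ker (gram_alternating f sk) li ki (fun j => ke (f j))).
Qed.

Lemma rank_pf6 w f : skew w -> (form_rank w < 6)%N -> pf6 (gram w f) = 0.
Proof.
move=> sk /(@gram_ker _ _ f) [k [i [li ki ke]]].
exact: (pf6_ker (gram_alternating f sk) li ki (fun j => ke (f j))).
Qed.

Lemma rank_wedge a b : wedge a b != 0 -> form_rank (wedge a b) = 2%N.
Proof.
move=> w0; apply/eqP; rewrite eqn_leq skew_rank_ge2 ?andbT //; last exact: skew_wedge.
pose r a : 'rV[K]_(\dim {:W}) := \row_i ap a (vbasis {:W})`_i.
have -> : form_rank (wedge a b) = \rank ((r a)^T *m r b - (r b)^T *m r a).
  congr (\rank _); apply/matrixP => i j; rewrite !mxE !big_ord1 !mxE.
  exact: ev_wedge.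
apply: leq_trans (mxrank_add _ _) _; rewrite mxrank_opp.
by apply: (@leq_add _ _ 1 1); apply: leq_trans (mxrankM_maxr _ _) (rank_leq_row _).
Qed.

End FormRank.

(** * Linear functionals on a subspace *)

Section LinearFunctionals.
Variables (K : fieldType) (V : vectType K).
Implicit Types (A U : {vspace V}) (v : V).

(** A group is not the union of two proper subgroups: if [p w1] and [q w2] are nonzero, neither
    factor vanishes at [w1 + w2]. *)
Lemma mul_eq0_on A (p q : V -> K) :
  {morph p : x y / x + y} -> {morph q : x y / x + y} ->
  (forall w, w \in A -> p w * q w = 0) ->
  (forall w, w \in A -> p w = 0) \/ (forall w, w \in A -> q w = 0).
Proof.
move=> pD qD pq0; have [p0|/existsNP [w1 /not_implyP [Aw1 pw1]]] :=
  pselect (forall w, w \in A -> p w = 0); first by left.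
right => w2 Aw2; apply/eqP.
have /eqP := pq0 _ Aw1; rewrite mulf_eq0 => /orP [/eqP//|/eqP qw1].
have /eqP := pq0 _ Aw2; rewrite mulf_eq0 => /orP [/eqP pw2|//].
have /eqP := pq0 _ (memvD Aw1 Aw2).
by rewrite pD qD pw2 qw1 addr0 add0r mulf_eq0 => /orP [/eqP|].
Qed.

Definition ker_on n (g : 'I_n -> dual V) A := (A :&: lker (linfun (ap_row g)))%VS.

Lemma ker_onP n (g : 'I_n -> dual V) A v :
  reflect (v \in A /\ forall i, ap (g i) v = 0) (v \in ker_on g A).
Proof.
rewrite memv_cap memv_ker lfunE /=; apply: (iffP andP) => -[Av gv]; split=> //.
  by move=> i; move/eqP/rowP/(_ i): gv; rewrite !mxE.
by apply/eqP/rowP => i; rewrite !mxE.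
Qed.

Lemma dim_ker_on n (g : 'I_n -> dual V) A : (\dim A <= \dim (ker_on g A) + n)%N.
Proof.
rewrite -(limg_ker_dim (linfun (ap_row g)) A) leq_add2l.
by apply: leq_trans (dimvS (subvf _)) _; rewrite dimvf /dim /= mul1n.
Qed.

Lemma ap_row_onto n (g : 'I_n -> dual V) A : \dim A = n ->
  (forall w, w \in A -> (forall i, ap (g i) w = 0) -> w = 0) ->
  forall r, exists2 w, w \in A & forall i, ap (g i) w = r i.
Proof.
move=> dimA inj r.
have k0 : ker_on g A = 0%VS.
  by apply/eqP; rewrite -subv0; apply/subvP => w /ker_onP [Aw /inj->] //; rewrite mem0v.
have : (\row_i r i : 'rV[K]_n) \in (linfun (ap_row g) @: A)%VS.
  rewrite (_ : (_ @: A)%VS = fullv) ?memvf //; apply/eqP.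
  by rewrite eqEdim subvf limg_dim_eq // dimA dimvf /dim /= mul1n leqnn.
case/memv_imgP => w Aw /rowP e; exists w => // i.
by move: (e i); rewrite lfunE !mxE.
Qed.

Lemma row_basis_mx n (S : {vspace 'rV[K]_n}) :
  \rank (\matrix_(i < \dim S) (vbasis S)`_i) = \dim S.
Proof.
apply/eqP; rewrite -/(row_free _) -kermx_eq0; apply/rowV0P => c /sub_kermxP c0.
apply/rowP => i; rewrite mxE.
have /freeP := basis_free (vbasisP S); apply.
apply: etrans c0; rewrite mulmx_sum_row.
by apply: eq_bigr => l _; rewrite rowK.
Qed.

Lemma orthogonal_dim n (S T : {vspace 'rV[K]_n}) :
  (forall s t, s \in S -> t \in T -> s *m t^T = 0) -> (\dim S + \dim T <= n)%N.
Proof.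
move=> ST; rewrite -(row_basis_mx S) -(row_basis_mx T).
rewrite -[X in (_ + X)%N]mxrank_tr; apply: mulmx0_rank_max.
apply/matrixP => i j; rewrite mxE.
have := ST _ _ (vbasis_mem (mem_nth 0 _)) (vbasis_mem (mem_nth 0 _)).
move=> /(_ i j); rewrite !size_tuple => /(_ (ltn_ord _) (ltn_ord _)).
move=> /matrixP /(_ 0 0); rewrite !mxE => e; apply: etrans e.
by apply: eq_bigr => l _; rewrite !mxE.
Qed.

(** A proper image would be annihilated by a nonzero row [c], that is, by a linear relation between
    the functionals on [A]. *)
Lemma ap_row_onto_indep n (g : 'I_n -> dual V) A :
  (forall c : 'I_n -> K, (forall w, w \in A -> \sum_i c i * ap (g i) w = 0) ->
    forall i, c i = 0) ->
  forall r, exists2 w, w \in A & forall i, ap (g i) w = r i.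
Proof.
move=> indep r; set S := (linfun (ap_row g) @: A)%VS.
have : (\row_i r i : 'rV[K]_n) \in S.
  suff -> : S = fullv by rewrite memvf.
  apply/eqP; rewrite eqEdim subvf dimvf /dim /= mul1n -(row_basis_mx S).
  set M := (X in \rank X); rewrite -mxrank_tr -/(row_free _).
  rewrite row_leq_rank -kermx_eq0; apply/rowV0P => c /sub_kermxP c0; apply/rowP => i; rewrite mxE.
  apply: indep => w Aw.
  have : linfun (ap_row g) w \in S by apply: memv_img.
  move=> /coord_vbasis; rewrite {1}lfunE => /rowP e.
  have gE j : ap (g j) w = \sum_l coord (vbasis S) l (linfun (ap_row g) w) * M l j.
    have := e j; rewrite mxE => ->.
    by rewrite summxE; apply: eq_bigr => l _; rewrite !mxE.
  under eq_bigr do rewrite gE mulr_sumr.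
  rewrite exchange_big big1 // => l _; under eq_bigr do rewrite mulrCA.
  rewrite -mulr_sumr; move/rowP/(_ l): c0; rewrite !mxE => c0.
  rewrite (_ : \sum_j _ = 0) ?mulr0 //; apply: etrans c0.
  by apply: eq_bigr => j _; rewrite [M^T _ _]mxE.
case/memv_imgP => w Aw /rowP e; exists w => // i.
by move: (e i); rewrite lfunE !mxE.
Qed.

(** The images of [A] under [g] and [h] are orthogonal in [K^n]; rank-nullity turns this into a
    bound on the kernels. *)
Lemma isotropic_dim n (g h : 'I_n -> dual V) A :
  (forall w w', w \in A -> w' \in A -> \sum_i ap (g i) w * ap (h i) w' = 0) ->
  (2 * \dim A <= \dim (ker_on g A) + \dim (ker_on h A) + n)%N.
Proof.
move=> gh; rewrite mul2n -addnn.
rewrite -{1}(limg_ker_dim (linfun (ap_row g)) A).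
rewrite -{1}(limg_ker_dim (linfun (ap_row h)) A) addnACA leq_add2l.
apply: orthogonal_dim => _ _ /memv_imgP [w Aw ->] /memv_imgP [w' Aw' ->].
apply/matrixP => i j; rewrite !lfunE !mxE -[RHS](gh w w') //.
by apply: eq_bigr => l _; rewrite !mxE.
Qed.

Lemma exists_not_multiple U v : (1 < \dim U)%N -> exists2 w, w \in U & w \notin <[v]>%VS.
Proof.
move=> dU; apply/subvPn; apply/negP => /dimvS.
by rewrite dim_vline => /(leq_trans dU); case: (v != 0).
Qed.

End LinearFunctionals.

(** * Elements of rank two *)

Section IsotropicPencil.
Variable K : fieldType.
Hypothesis two_neq0 : 2 != 0 :> K.
Hypothesis K_closed : GRing.closed_field_axiom K.
Implicit Types e w : nat -> nat -> K.

Lemma eq_pf6 e e' : (forall i j, e i j = e' i j) -> pf6 e = pf6 e'.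
Proof. by move=> ee'; rewrite /pf6 !ee'. Qed.

Lemma eq_pf4 e e' : (forall i j, e i j = e' i j) -> pf4 e = pf4 e'.
Proof. by move=> ee'; rewrite /pf4 !ee'. Qed.

(** The Gram matrix of a form of rank 4 with hyperbolic pairs (0, 1) and (2, 3) and with vectors 4
    and 5 spanning the kernel. *)
Definition symplectic4 w :=
  [/\ [/\ w 0%N 1%N = 1, w 0%N 2%N = 0, w 0%N 3%N = 0 & w 0%N 4%N = 0 /\ w 0%N 5%N = 0],
      [/\ w 1%N 2%N = 0, w 1%N 3%N = 0, w 1%N 4%N = 0 & w 1%N 5%N = 0],
      [/\ w 2%N 3%N = 1, w 2%N 4%N = 0 & w 2%N 5%N = 0],
      w 3%N 4%N = 0 /\ w 3%N 5%N = 0 & w 4%N 5%N = 0].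

(* The coefficients of [t ^ 2] and [t] in [pf6 (e + t * w)]. *)
Lemma pf6_tangent e w : symplectic4 w ->
  (forall t, pf6 (fun i j => e i j + t * w i j) = 0) ->
  e 4%N 5%N = 0 /\
  e 0%N 5%N * e 1%N 4%N - e 0%N 4%N * e 1%N 5%N
    + e 2%N 5%N * e 3%N 4%N - e 2%N 4%N * e 3%N 5%N = 0.
Proof.
move=> [[w01 w02 w03 [w04 w05]] [w12 w13 w14 w15] [w23 w24 w25] [w34 w35] w45] pf.
(* The polynomial is quadratic in [t]; its values at 0, 1 and -1 give twice each coefficient. *)
have pf0 := pf 0; have pf1 := pf 1; have pfN := pf (- 1).
move: pf0 pf1 pfN; rewrite /pf6 w01 w02 w03 w04 w05 w12 w13 w14 w15 w23 w24 w25.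
rewrite w34 w35 w45 => pf0 pf1 pfN.
have e45 : e 4%N 5%N = 0.
  apply: (mulfI two_neq0); apply: (addcomb (c := - 1) pf1).
  by apply: (addcomb (c := - 1) pfN); apply: (addcomb (c := 2) pf0); ring.
split; first exact: e45.
apply: (mulfI two_neq0); apply: (addcomb (c := - 1) pf1).
by apply: (addcomb (c := 1) pfN); rewrite e45; ring.
Qed.

Variables (V : vectType K) (E : nat -> nat -> dual V).
Variable g : V -> nat -> nat -> K.
Hypothesis EE : forall i j v, ap (E i j) v = g v i j.
Hypothesis g_pf6 : forall v, pf6 (g v) = 0.
Hypothesis dimV : \dim {:V} = 6%N.

Let gD v1 v2 i j : g (v1 + v2) i j = g v1 i j + g v2 i j.
Proof. by rewrite -!EE apD. Qed.

Let gZ c v i j : g (c *: v) i j = c * g v i j.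
Proof. by rewrite -!EE apZ. Qed.

(* For [v] of rank 4 with kernel [<f 4, f 5>], the pairing of [f 4], [f 5] with *)
(* [f 0 .. f 3] maps the space of forms into an isotropic subspace of an        *)
(* 8-dimensional quadratic space, hence has rank at most 4.                     *)
Lemma exists_common_kernel v : symplectic4 (g v) ->
  exists e : V, [/\ e \notin <[v]>%VS &
    [/\ g e 0%N 4%N = 0, g e 1%N 4%N = 0, g e 2%N 4%N = 0 & g e 3%N 4%N = 0] /\
    [/\ g e 0%N 5%N = 0, g e 1%N 5%N = 0, g e 2%N 5%N = 0 & g e 3%N 5%N = 0] /\
    g e 4%N 5%N = 0].
Proof.
move=> sv.
have tg (e : V) : g e 4%N 5%N = 0 /\
  g e 0%N 5%N * g e 1%N 4%N - g e 0%N 4%N * g e 1%N 5%N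
    + g e 2%N 5%N * g e 3%N 4%N - g e 2%N 4%N * g e 3%N 5%N = 0.
  apply: (pf6_tangent sv) => t.
  rewrite -[RHS](g_pf6 (e + t *: v)).
  by apply: eq_pf6 => i j; rewrite gD gZ.
(* [q] lists the polar partners of [p]: the sum of the [p i a * q i b] is the polarization of the
   quadratic relation in [tg]. *)
pose p (i : 'I_8) := nth 0 [:: E 0 4; E 1 4; E 2 4; E 3 4; E 0 5; E 1 5; E 2 5; E 3 5] i.
pose q (i : 'I_8) := nth 0
  [:: - E 1 5; E 0 5; - E 3 5; E 2 5; E 1 4; - E 0 4; E 3 4; - E 2 4] i.
have kerqp : (ker_on q fullv <= ker_on p fullv)%VS.
  apply/subvP => e /ker_onP [_ qe]; apply/ker_onP; split; first exact: memvf.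
  have qE j (lj : (j < 8)%N) := qe (Ordinal lj).
  have := (qE 0%N isT, qE 1%N isT, qE 2%N isT, qE 3%N isT).
  have := (qE 4%N isT, qE 5%N isT, qE 6%N isT, qE 7%N isT).
  rewrite /q /= !apNf => -[[[q4 q5] q6] q7] [[[q0 q1] q2] q3].
  have opp0 (x : K) : - x = 0 -> x = 0 by move/eqP; rewrite oppr_eq0 => /eqP.
  by case=> i li; rewrite /p /=; do 8?[case: i li => [|i] //= li]; apply: opp0.
have le2 : (2 * \dim {:V} <= \dim (ker_on p fullv) + \dim (ker_on q fullv) + 8)%N.
  apply: isotropic_dim => a b _ _.
  rewrite !big_ord_recr big_ord0 /p /q /= !apNf !EE.
  have [_ La] := tg a; have [_ Lb] := tg b.
  have [_] := tg (a + b); rewrite !(gD a b) => Lab.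
  apply: (addcomb (c := - 1) Lab); apply: (addcomb (c := 1) La).
  by apply: (addcomb (c := 1) Lb); ring.
(* By [kerqp] and [le2], 12 is at most twice this dimension plus 8. *)
have dim2 : (1 < \dim (ker_on p fullv))%N.
  have le_qp := dimvS kerqp; rewrite dimV in le2.
  move: (\dim (ker_on p fullv)) (\dim (ker_on q fullv)) le_qp le2 => m n; lia.
have [e /ker_onP [_ pe] ev] := exists_not_multiple v dim2.
have pE j (lj : (j < 8)%N) := pe (Ordinal lj).
have := (pE 0%N isT, pE 1%N isT, pE 2%N isT, pE 3%N isT).
have := (pE 4%N isT, pE 5%N isT, pE 6%N isT, pE 7%N isT).
rewrite /p /= !EE => -[[[p4 p5] p6] p7] [[[p0 p1] p2] p3].
by exists e; split=> //; split; [split|split; [split|have [] := tg e]].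
Qed.

(** Along [e + t *: v] vectors 4 and 5 stay in the kernel, and the Pfaffian on the other four is a
    monic quadratic in [t], which has a root in [K]. *)
Lemma exists_degenerate v : symplectic4 (g v) ->
  exists u, [/\ u != 0, pf4 (g u) = 0 &
    forall i j, (i < j)%N -> (3 < j < 6)%N -> g u i j = 0].
Proof.
move=> sv; have [e [ev [[e04 e14 e24 e34] [[e05 e15 e25 e35] e45]]]] :=
  exists_common_kernel sv.
move: (sv) => [[v01 v02 v03 [v04 v05]] [v12 v13 v14 v15] [v23 v24 v25] [v34 v35] v45].
have [t tE] : exists t, pf4 (fun i j => g e i j + t * g v i j) = 0.
  pose c i := nth 0 [:: - pf4 (g e); - (g e 0%N 1%N + g e 2%N 3%N)] i.
  have [t] := K_closed c (isT : 0 < 2)%N.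
  rewrite !big_ord_recr big_ord0 /c /= add0r => tE; exists t.
  rewrite /pf4 v01 v02 v03 v12 v13 v23.
  by apply: (addcomb (c := - 1) tE); rewrite /pf4; ring.
exists (e + t *: v); split.
- apply: contra ev; rewrite addr_eq0 => /eqP ->.
  by rewrite -scaleNr memvZ // memv_line.
- by apply: etrans tE; apply: eq_pf4 => i j; rewrite gD gZ.
move=> i j; rewrite gD gZ.
by do 6?[case: j => [|j] //]; do 5?[case: i => [|i] //] => _ _;
  rewrite ?e04 ?e14 ?e24 ?e34 ?e05 ?e15 ?e25 ?e35 ?e45 ?v04 ?v14 ?v24 ?v34
  ?v05 ?v15 ?v25 ?v35 ?v45 mulr0 addr0.
Qed.

End IsotropicPencil.

Section RankTwoElement.
Variables (K : fieldType) (W V : vectType K).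
Hypothesis two_neq0 : 2 != 0 :> K.
Hypothesis K_closed : GRing.closed_field_axiom K.
(* [V] is a linear space of skew forms on [W], evaluated by [ev]; [L] and [E]  *)
(* exhibit [ev] as linear in its last and in its first argument. It will be    *)
(* instantiated with the vector space underlying [A].                          *)
Variables (ev : V -> W -> W -> K) (L : V -> W -> dual W) (E : W -> W -> dual V).
Hypothesis apL : forall w u v, ap (L w u) v = ev w u v.
Hypothesis apE : forall w u v, ap (E u v) w = ev w u v.
Hypothesis ev_skew : forall w u v, ev w v u = - ev w u v.
Hypothesis ev_neq0 : forall w, w != 0 -> exists u v, ev w u v != 0.
Implicit Types (w p : V) (u v : W) (f : nat -> W).

Definition entries w f i j := ev w (f i) (f j).

Lemma fam_Dr w u v1 v2 : ev w u (v1 + v2) = ev w u v1 + ev w u v2.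
Proof. by rewrite -!apL apD. Qed.

Lemma fam_Zr w c u v : ev w u (c *: v) = c * ev w u v.
Proof. by rewrite -!apL apZ. Qed.

Lemma fam_Dl w u1 u2 v : ev w (u1 + u2) v = ev w u1 v + ev w u2 v.
Proof. by rewrite !(ev_skew w v) fam_Dr opprD. Qed.

Lemma fam_Zl w c u v : ev w (c *: u) v = c * ev w u v.
Proof. by rewrite !(ev_skew w v) fam_Zr mulrN. Qed.

Lemma fam_Df w1 w2 u v : ev (w1 + w2) u v = ev w1 u v + ev w2 u v.
Proof. by rewrite -!apE apD. Qed.

Lemma fam_Zf c w u v : ev (c *: w) u v = c * ev w u v.
Proof. by rewrite -!apE apZ. Qed.

Lemma fam_diag w u : ev w u u = 0.
Proof.
have /eqP := ev_skew w u u.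
by rewrite -addr_eq0 -mulr2n -mulr_natl mulf_eq0 (negPf two_neq0) => /eqP.
Qed.

Hypothesis dimW : \dim {:W} = 6%N.

Lemma ev_rank4 f x w : dual_pair 6 f x ->
  (forall i j, (i < j)%N -> (3 < j < 6)%N -> entries w f i j = 0) -> forall u v,
  let d i j := ap (x i) u * ap (x j) v - ap (x j) u * ap (x i) v in
  let e := entries w f in
  ev w u v = e 0%N 1%N * d 0%N 1%N + e 0%N 2%N * d 0%N 2%N + e 0%N 3%N * d 0%N 3%N
    + e 1%N 2%N * d 1%N 2%N + e 1%N 3%N * d 1%N 3%N + e 2%N 3%N * d 2%N 3%N.
Proof.
move=> fx z u v d e.
transitivity (ev w (\sum_(i < 6) ap (x i) u *: f i) (\sum_(i < 6) ap (x i) v *: f i)).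
  by rewrite -!(dual_pair_decomp dimW fx).
rewrite !big_ord_recr !big_ord0 /= !add0r !fam_Dl !fam_Dr !(fam_Zl, fam_Zr) !fam_diag.
rewrite -!/(entries w f _ _).
have eN i j : entries w f i j = - entries w f j i by apply: ev_skew.
rewrite ![entries w f _ 0]eN ![entries w f 2 1]eN ![entries w f 3 1]eN.
rewrite ![entries w f 4 1]eN ![entries w f 5 1]eN ![entries w f 3 2]eN.
rewrite ![entries w f 4 2]eN ![entries w f 5 2]eN ![entries w f 4 3]eN.
rewrite ![entries w f 5 3]eN ![entries w f 5 4]eN.
rewrite !(z _ 4) // !(z _ 5) // /d /e; ring.
Qed.

(** With [f 4] and [f 5] in its kernel, [w] depends on four coordinates only. Its Pfaffian on any
    four vectors is [pf4 (entries w f)] times the determinant of their coordinates, written out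
    below. *)
Lemma pf4_rank2 f x w : dual_pair 6 f x ->
  (forall i j, (i < j)%N -> (3 < j < 6)%N -> entries w f i j = 0) ->
  pf4 (entries w f) = 0 -> forall g, pf4 (entries w g) = 0.
Proof.
move=> fx z pf0 g; have wE := ev_rank4 fx z.
pose y i j := ap (x i) (g j).
rewrite {1}/pf4 {1 2 3 4 5 6}/entries !wE -!/(y _ _).
set d := (d in _ = d).
transitivity (pf4 (entries w f) *
 (y 0%N 0%N * (y 1%N 1%N * (y 2%N 2%N * y 3%N 3%N - y 2%N 3%N * y 3%N 2%N)
          - y 1%N 2%N * (y 2%N 1%N * y 3%N 3%N - y 2%N 3%N * y 3%N 1%N)
          + y 1%N 3%N * (y 2%N 1%N * y 3%N 2%N - y 2%N 2%N * y 3%N 1%N))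
  - y 0%N 1%N * (y 1%N 0%N * (y 2%N 2%N * y 3%N 3%N - y 2%N 3%N * y 3%N 2%N)
          - y 1%N 2%N * (y 2%N 0%N * y 3%N 3%N - y 2%N 3%N * y 3%N 0%N)
          + y 1%N 3%N * (y 2%N 0%N * y 3%N 2%N - y 2%N 2%N * y 3%N 0%N))
  + y 0%N 2%N * (y 1%N 0%N * (y 2%N 1%N * y 3%N 3%N - y 2%N 3%N * y 3%N 1%N)
          - y 1%N 1%N * (y 2%N 0%N * y 3%N 3%N - y 2%N 3%N * y 3%N 0%N)
          + y 1%N 3%N * (y 2%N 0%N * y 3%N 1%N - y 2%N 1%N * y 3%N 0%N))
  - y 0%N 3%N * (y 1%N 0%N * (y 2%N 1%N * y 3%N 2%N - y 2%N 2%N * y 3%N 1%N)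
          - y 1%N 1%N * (y 2%N 0%N * y 3%N 2%N - y 2%N 2%N * y 3%N 0%N)
          + y 1%N 2%N * (y 2%N 0%N * y 3%N 1%N - y 2%N 1%N * y 3%N 0%N))));
  last by rewrite pf0 mul0r.
by rewrite /pf4; ring.
Qed.

(* [p] is the wedge of the functionals [ev p u] and [ev p v]. *)
Definition decomposable_at p u v := ev p u v = 1 /\
  forall x y, ev p x y = ev p u x * ev p v y - ev p u y * ev p v x.

(** After scaling [ev p u v] to 1, the vanishing Pfaffian on [u, v, x, y] expresses [p] through its
    rows at [u] and [v]. *)
Lemma pf4_decomposable p : p != 0 -> (forall g, pf4 (entries p g) = 0) ->
  exists c u v, decomposable_at (c *: p) u v.
Proof.
move=> /ev_neq0 [u [v uv]] pf0; exists (ev p u v)^-1, u, v; split.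
  by rewrite fam_Zf mulVf.
move=> x y; rewrite !fam_Zf; have := pf0 (nth 0 [:: u; v; x; y]).
rewrite /pf4 /entries /= => e; apply: (mulfI uv); apply: (mulfI uv).
by apply: (addcomb (c := - 1) e); field.
Qed.

Hypothesis ev_pf6 : forall w f, pf6 (entries w f) = 0.
Hypothesis dimV : \dim {:V} = 6%N.

Lemma exists_decomposable : exists p u v, decomposable_at p u v.
Proof.
have V0 : vpick {:V} != 0 by rewrite vpick0 -dimv_eq0 dimV.
have [u [v uv]] := ev_neq0 V0.
have [w w1] : exists w, ev w u v = 1.
  by exists ((ev (vpick {:V}) u v)^-1 *: vpick {:V}); rewrite fam_Zf mulVf.
(* Either [w] is decomposable, or [x] and [y] witness rank at least 4. Then [pr], the projection to
   the [w]-orthogonal of [u] and [v], gives a second hyperbolic pair. *)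
have [d|/existsNP [x /existsNP [y xy]]] :=
  pselect (forall x y, ev w x y = ev w u x * ev w v y - ev w u y * ev w v x).
  by exists w, u, v.
have wN := ev_skew w; have w0 := fam_diag w.
pose pr z := z + ev w v z *: u - ev w u z *: v.
have pru z : ev w u (pr z) = 0.
  by rewrite /pr -scaleNr !(fam_Dr, fam_Zr) w0 w1; ring.
have prv z : ev w v (pr z) = 0.
  by rewrite /pr -scaleNr !(fam_Dr, fam_Zr) w0 (wN u v) w1; ring.
have s0 : ev w (pr x) (pr y) != 0.
  apply/eqP => s; apply: xy; move: s; rewrite {2}/pr -scaleNr !(fam_Dr, fam_Zr).
  rewrite (wN u (pr x)) (wN v (pr x)) pru prv /pr -scaleNr !(fam_Dl, fam_Zl) => s.
  by apply: (addcomb (c := - 1) s); ring.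
pose y' := (ev w (pr x) (pr y))^-1 *: pr y.
have yu : ev w u y' = 0 by rewrite fam_Zr pru mulr0.
have yv : ev w v y' = 0 by rewrite fam_Zr prv mulr0.
have xy1 : ev w (pr x) y' = 1 by rewrite fam_Zr mulVf.
have xu := pru x; have xv := prv x.
move: (pr x) y' xu xv yu yv xy1 {pru prv s0 xy} => {pr}x {}y xu xv yu yv xy1.
pose f := nth 0 [:: u; v; x; y].
(* The functionals are read off from [w], so the two vectors completing [f] are [w]-orthogonal to
   [u, v, x, y]; the Pfaffian then reduces to the entry (4, 5). *)
have fx : dual_pair 4 f (nth 0 [:: - L w v; L w u; - L w y; L w x]).
  move=> i j li lj; do 4?[case: i li => [|i] //= li]; do 4?[case: j lj => [|j] //= lj];
  by rewrite ?apNf /f /= apL ?w0 ?(wN u v) ?(wN u x) ?(wN v x)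
    ?(wN u y) ?(wN v y) ?(wN x y) ?xu ?xv ?yu ?yv ?w1 ?xy1 ?oppr0 ?opprK.
have [f' [x' [f'x f'E x'E]]] := @dual_pair_complete _ _ 4 2 _ _ dimW fx.
have [f0 f1 f2 f3] : [/\ f' 0%N = u, f' 1%N = v, f' 2%N = x & f' 3%N = y].
  by rewrite !f'E.
have z4 j : (3 < j < 6)%N -> [/\ ev w u (f' j) = 0, ev w v (f' j) = 0,
     ev w x (f' j) = 0 & ev w y (f' j) = 0].
  move=> /andP [j3 j6].
  have xz i : (i < 4)%N -> ap (x' i) (f' j) = 0.
    by move=> li; rewrite f'x ?(ltn_eqF (leq_trans li j3)) //; apply: ltn_trans li _.
  have := (xz 0%N isT, xz 1%N isT, xz 2%N isT, xz 3%N isT).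
  rewrite !x'E //= !apNf !apL.
  move=> [[[/eqP a b] /eqP c] d]; move: a c; rewrite !oppr_eq0 => /eqP a /eqP c.
  by split.
have [z04 z14 z24 z34] := z4 4%N isT; have [z05 z15 z25 z35] := z4 5%N isT.
have w45 : ev w (f' 4%N) (f' 5%N) = 0.
  have := ev_pf6 w f'; rewrite /pf6 /entries f0 f1 f2 f3 z04 z14 z24 z34 z05 z15 z25 z35.
  by rewrite w1 xu xv yu yv xy1 => <-; ring.
have sw : symplectic4 (entries w f').
  by rewrite /symplectic4 /entries f0 f1 f2 f3.
have [p [p0 pfp pz]] := exists_degenerate two_neq0 K_closed
  (fun i j w => apE w (f' i) (f' j)) (fun w => ev_pf6 w f') dimV sw.
have [c [u' [v' d]]] := pf4_decomposable p0 (pf4_rank2 f'x pz pfp).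
by exists (c *: p), u', v'.
Qed.

End RankTwoElement.

(** * The line orthogonal to the residual 4-space *)

Section ResidualLine.
Variables (K : fieldType) (W V : vectType K).
Hypothesis two_neq0 : 2 != 0 :> K.
Variables (ev : V -> W -> W -> K) (L : V -> W -> dual W) (E : W -> W -> dual V).
Hypothesis apL : forall w u v, ap (L w u) v = ev w u v.
Hypothesis apE : forall w u v, ap (E u v) w = ev w u v.
Hypothesis ev_skew : forall w u v, ev w v u = - ev w u v.
Hypothesis dimW : \dim {:W} = 6%N.
Hypothesis ev_pf6 : forall w f, pf6 (entries ev w f) = 0.
Hypothesis no_isotropic3 : forall x y z, free [:: x; y; z] ->
  ~ forall w, [/\ ev w x y = 0, ev w x z = 0 & ev w y z = 0].
Implicit Types (w p : V) (u v x y z k l : W) (f : nat -> W).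

Let fam_Dr := fam_Dr apL.
Let fam_Zr := fam_Zr apL.
Let fam_Df := fam_Df apE.
Let fam_Zf := fam_Zf apE.
Let fam_Dl := fam_Dl apL ev_skew.
Let fam_Zl := fam_Zl apL ev_skew.
Let fam_diag := fam_diag two_neq0 ev_skew.

Variables (p : V) (u v : W).
Hypothesis p_dec : decomposable_at ev p u v.
Let U z := ev p u z = 0 /\ ev p v z = 0.

(* The part of [pf6 (w + p)] linear in [p]. *)
Lemma pf4_residual w a b c d : U a -> U b -> U c -> U d ->
  pf4 (entries ev w (nth 0 [:: a; b; c; d])) = 0.
Proof.
case: p_dec => puv pE [ua va] [ub vb] [uc vc] [ud vd].
have pz a' b' : ev p u a' = 0 -> ev p v a' = 0 -> ev p a' b' = 0.
  by move=> ea eb; rewrite pE ea eb mul0r mulr0 subr0.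
pose f := nth 0 [:: u; v; a; b; c; d].
have := ev_pf6 w f; have := ev_pf6 (w + p) f.
rewrite /pf6 /pf4 /entries /= !fam_Df puv ua va ub vb uc vc ud vd.
rewrite !(pz a _ ua va) !(pz b _ ub vb) !(pz c _ uc vc) => pf1 pf0.
by apply: (addcomb (c := - 1) pf1); apply: (addcomb (c := 1) pf0); ring.
Qed.

(** [l, x, y, k] form a basis of the 4-space [U], and [l] spans the line orthogonal to [U] for all
    forms. *)
Definition residual_line x y k l := [/\ free [:: u; v; l; x; y; k], U x /\ U y, U k /\ U l &
  forall w, [/\ ev w l x = 0, ev w l y = 0 & ev w l k = 0]].

Lemma free_shear x y k l a b : free [:: u; v; x; y; k; l] ->
  free [:: u; v; x; y - a *: x; k; l - b *: k].
Proof.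
move=> /free_dual [d du].
pose d' := nth 0 [:: d 0%N; d 1%N; d 2%N + a *: d 3%N; d 3%N; d 4%N + b *: d 5%N; d 5%N].
apply: (@dual_pair_free _ _ 6 (nth 0 [:: u; v; x; y - a *: x; k; l - b *: k]) d').
have dd i j li lj := du i j li lj.
have := (dd^~ 0%N, dd^~ 1%N, dd^~ 2%N, dd^~ 3%N, dd^~ 4%N, dd^~ 5%N).
move=> [[[[[d0 d1] d2] d3] d4] d5] i j li lj.
do 6?[case: i li => [|i] //= li]; do 6?[case: j lj => [|j] //= lj];
rewrite /d' /= -?scaleNr ?apDf ?apZf ?apD ?apZ ?apDf ?apZf ?d0 ?d1 ?d2 ?d3 ?d4 ?d5 //=; ring.
Qed.

(* The restrictions to the common kernel [U] of [ev p u] and [ev p v] are an    *)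
(* isotropic space for the Klein quadric, so they share a kernel vector or an   *)
(* isotropic 3-space; the latter is excluded by stability.                      *)
Lemma residual_line_pivot x y k l w : free [:: u; v; x; y; k; l] ->
  U x -> U y -> U k -> U l -> (forall w', ev w' k l = 0) -> ev w x k != 0 ->
  exists x' y' k' l', residual_line x' y' k' l'.
Proof.
move=> fr Ux Uy Uk Ul kl0 xk.
have {xk} [{}w xk] : exists w, ev w x k = 1.
  by exists ((ev w x k)^-1 *: w); rewrite fam_Zf mulVf.
(* The pivot [ev w x k = 1] clears two entries of [w], so that the Pfaffian relation polarized at
   [w] isolates [ev e y' l']. *)
pose y' := y - ev w y k *: x; pose l' := l - ev w x l *: k.
have fr' : free [:: u; v; x; y'; k; l'] by apply: free_shear.
have U_sub z z' c : U z -> U z' -> U (z - c *: z').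
  move=> [a1 a2] [b1 b2]; rewrite /U -scaleNr !fam_Dr !fam_Zr a1 a2 b1 b2.
  by rewrite mulr0 addr0.
have Uy' : U y' by apply: U_sub.
have Ul' : U l' by apply: U_sub.
have yk : ev w y' k = 0 by rewrite /y' -scaleNr fam_Dl fam_Zl xk mulr1 subrr.
have xl : ev w x l' = 0 by rewrite /l' -scaleNr fam_Dr fam_Zr xk mulr1 subrr.
have kl e : ev e k l' = 0 by rewrite /l' -scaleNr fam_Dr fam_Zr fam_diag kl0 mulr0 addr0.
move: y' l' fr' Uy' Ul' yk xl kl => {fr kl0 Uy Ul}y' l' fr Uy Ul yk xl kl.
have pf e : ev e x l' * ev e y' k - ev e x k * ev e y' l' = 0.
  have := pf4_residual e Ux Uy Uk Ul; rewrite /pf4 /entries /= kl mulr0 => <-; ring.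
have yl e : ev e y' l' = 0.
  have := pf (w + e); have := pf e; have := pf w; rewrite !fam_Df xk yk xl.
  move=> pfw pfe pfs; apply: (addcomb (c := 1) pfs).
  apply: (addcomb (c := - 1 - ev e x k) pfw).
  by apply: (addcomb (c := -1) pfe); ring.
have pf' e : e \in {:V}%VS -> ev e x l' * ev e y' k = 0.
  by move=> _; rewrite -[RHS](pf e) yl mulr0 subr0.
(* Of the two linear factors one vanishes identically: either [l'] is orthogonal to [U], or [y'],
   [k], [l'] span an isotropic 3-space. *)
have [] := mul_eq0_on _ _ pf'; try by move=> e e'; apply: fam_Df.
  move=> xl0; exists x, y', k, l'; split; try by split.
    by rewrite (@perm_free _ _ _ [:: u; v; x; y'; k; l']) //; apply/permP => a /=; lia.
  move=> e; split; rewrite ev_skew ?kl ?yl ?xl0 ?oppr0 //; exact: memvf.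
move=> yk0; case: (@no_isotropic3 y' k l').
  by move: fr; rewrite -[_ :: _]/([:: u; v; x] ++ _); apply: catr_free.
by move=> e; split; rewrite ?yk0 ?yl ?kl // memvf.
Qed.

(** Some form [w] pairs [x] and [y] in [U] to 1; let [k], [l] span their [w]-orthogonal in [U].
    Polarizing at [w] makes [k] and [l] orthogonal for all forms. Either [k] is orthogonal to [U]
    and takes the place of [l], or its pairing with [x] or [y] is a pivot. *)
Lemma exists_residual_line : exists x y k l, residual_line x y k l.
Proof.
case: (p_dec) => puv pE; have pN := ev_skew p; have p0 := fam_diag p.
have [w [x [y [Ux Uy xy]]]] : exists w x y, [/\ U x, U y & ev w x y = 1].
  have [|s [sz fs s0]] := @ker_free _ _ [:: L p u; L p v] 3; first by rewrite dimW.
  case: s sz fs s0 => [|a [|b [|c [|? ?]]]] // _ fs s0.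
  have Us z : z \in [:: a; b; c] -> U z.
    by move=> zs; split; rewrite -apL; apply: s0 (zs); rewrite !inE eqxx ?orbT.
  have [Ua Ub Uc] : [/\ U a, U b & U c].
    by split; apply: Us; rewrite !inE eqxx ?orbT.
  have [w nw] : exists w, ~ [/\ ev w a b = 0, ev w a c = 0 & ev w b c = 0].
    by apply: contrapT => h; apply: (no_isotropic3 fs) => w; apply: contrapT => h';
      apply: h; exists w.
  have [ab|ab] := eqVneq (ev w a b) 0; last first.
    by exists ((ev w a b)^-1 *: w), a, b; split; rewrite // fam_Zf mulVf.
  have [ac|ac] := eqVneq (ev w a c) 0; last first.
    by exists ((ev w a c)^-1 *: w), a, c; split; rewrite // fam_Zf mulVf.
  have [bc|bc] := eqVneq (ev w b c) 0; first by case: nw.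
  by exists ((ev w b c)^-1 *: w), b, c; split; rewrite // fam_Zf mulVf.
have wN := ev_skew w; have w0 := fam_diag w.
pose f := nth 0 [:: u; v; x; y].
have [[ux vx] [uy vy]] := (Ux, Uy).
(* The last two functionals are corrected for the pairings of [w] with [u] and [v]. The common
   kernel of the four consists of the vectors of [U] that are [w]-orthogonal to [x] and [y]. *)
have fx : dual_pair 4 f (nth 0 [:: - L p v; L p u;
    - L w y - ev w y u *: L p v + ev w y v *: L p u;
    L w x + ev w x u *: L p v - ev w x v *: L p u]).
  move=> i j li lj; do 4?[case: i li => [|i] //= li]; do 4?[case: j lj => [|j] //= lj];
  by rewrite ?(apDf, apNf, apZf) /f /= ?apL ?p0 ?(pN u v) ?puv ?ux ?vx ?uy ?vy ?w0
    ?(wN x y) ?xy; ring.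
have [g [d [gd gE dE]]] := @dual_pair_complete _ _ 4 2 _ _ dimW fx.
have [g0 g1 g2 g3] : [/\ g 0%N = u, g 1%N = v, g 2%N = x & g 3%N = y].
  by rewrite !gE.
have gz j : (3 < j < 6)%N -> [/\ U (g j), ev w x (g j) = 0 & ev w y (g j) = 0].
  move=> /andP [j3 j6].
  have dz i : (i < 4)%N -> ap (d i) (g j) = 0.
    by move=> li; rewrite gd ?(ltn_eqF (leq_trans li j3)) //; apply: ltn_trans li _.
  have := (dz 0%N isT, dz 1%N isT, dz 2%N isT, dz 3%N isT).
  rewrite !dE //= !(apDf, apNf, apZf) !apL => -[[[/eqP]]].
  rewrite oppr_eq0 => /eqP vj uj; rewrite vj uj !mulr0 oppr0 !addr0 => /eqP.
  by rewrite oppr_eq0 => /eqP.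
have [Uk xk yk] := gz 4%N isT; have [Ul xl yl] := gz 5%N isT.
have fr : free [:: u; v; x; y; g 4%N; g 5%N].
  by have := dual_pair_free gd; rewrite /mkseq /= g0 g1 g2 g3.
move: (g 4%N) (g 5%N) Uk Ul xk yk xl yl fr => k l Uk Ul xk yk xl yl fr.
have kl e : ev e k l = 0.
  have := pf4_residual w Ux Uy Uk Ul; have := pf4_residual e Ux Uy Uk Ul.
  have := pf4_residual (w + e) Ux Uy Uk Ul.
  rewrite /pf4 /entries /= !fam_Df xy xk yk xl yl => pf1 pfe pfw.
  have {}pfw : ev w k l = 0 by rewrite -[RHS]pfw; ring.
  apply: (addcomb (c := - 1) pf1); apply: (addcomb (c := 1) pfe).
  by rewrite pfw; ring.
have perm (s t : seq W) : free s -> perm_eq t s -> free t.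
  by move=> fs /perm_free ->.
have lk e : ev e l k = 0 by rewrite ev_skew kl oppr0.
have [h|/existsNP [e /eqP]] := pselect (forall e, ev e x k = 0); last first.
  exact: residual_line_pivot fr Ux Uy Uk Ul kl.
have [h'|/existsNP [e /eqP]] := pselect (forall e, ev e y k = 0); last first.
  apply: residual_line_pivot Uy Ux Uk Ul kl.
  by apply: perm fr _; apply/permP => a /=; lia.
exists x, y, l, k; split; try by split.
  by apply: perm fr _; apply/permP => a /=; lia.
by move=> e; split; rewrite ev_skew ?h ?h' ?lk oppr0.
Qed.

End ResidualLine.

(** * The normal form *)

Section CubicRelation.
Variables (K : fieldType) (V : vectType K).
Hypothesis two_neq0 : 2 != 0 :> K.
Variables l m n x3 x4 x5 y3 y4 y5 t3 t4 t5 : dual V.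
Implicit Types w e : V.

(** With [l, m, n] for lam, mu, nu, these pair the x and y of [e] with the tau of [w]; [cubic] is
    the Pfaffian <tau, mu x - lam y>. *)
Let xt e w := ap x3 e * ap t3 w + ap x4 e * ap t4 w + ap x5 e * ap t5 w.
Let yt e w := ap y3 e * ap t3 w + ap y4 e * ap t4 w + ap y5 e * ap t5 w.

Hypothesis cubic : forall w, ap m w * xt w w - ap l w * yt w w = 0.
Hypothesis lm_indep : forall a b, (forall w, a * ap l w + b * ap m w = 0) ->
  a = 0 /\ b = 0.
Hypothesis t_indep : forall a b c,
  (forall w, a * ap t3 w + b * ap t4 w + c * ap t5 w = 0) ->
  [/\ a = 0, b = 0 & c = 0].
Hypothesis inj : forall w, ap l w = 0 -> ap m w = 0 -> ap n w = 0 ->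
  [/\ ap x3 w = 0, ap x4 w = 0 & ap x5 w = 0] ->
  [/\ ap y3 w = 0, ap y4 w = 0 & ap y5 w = 0] ->
  [/\ ap t3 w = 0, ap t4 w = 0 & ap t5 w = 0] -> w = 0.
Hypothesis dimV : \dim {:V} = 6%N.

(** The obstruction to (lam, mu, nu, tau) being coordinates. *)
Let D e := [/\ ap l e = 0, ap m e = 0, ap n e = 0 &
  [/\ ap t3 e = 0, ap t4 e = 0 & ap t5 e = 0]].

(* On the direction [e] the cubic relation says that the vectors [(l, m)] and   *)
(* [(xt e, yt e)] are everywhere parallel.                                      *)
Lemma D_proportional e : D e ->
  exists c, forall w, xt e w = c * ap l w /\ yt e w = c * ap m w.
Proof.
move=> [le me _ [t3e t4e t5e]].
have quad w : ap m w * xt e w - ap l w * yt e w = 0.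
  have := cubic (w + e); rewrite /xt /yt !apD le me t3e t4e t5e !addr0 => c1.
  by apply: (addcomb (c := - 1) c1); apply: (addcomb (c := 1) (cubic w));
    rewrite /xt /yt; ring.
have xtD w w' : xt e (w + w') = xt e w + xt e w' by rewrite /xt !apD; ring.
have ytD w w' : yt e (w + w') = yt e w + yt e w' by rewrite /yt !apD; ring.
have onto a b : exists w, ap l w = a /\ ap m w = b.
  have [c c0|w _ we] := ap_row_onto_indep
    (g := fun i : 'I_2 => nth 0 [:: l; m] i) (A := fullv) _ (fun i => nth 0 [:: a; b] i).
    have [|c1 c2] := lm_indep (a := c 0) (b := c 1).
      by move=> w; have := c0 w (memvf w); rewrite !big_ord_recl big_ord0 addr0
        (_ : lift _ _ = 1) //; apply: val_inj.
    case=> i li; case: i li => [|[|i]] // li; [rewrite -c1|rewrite -c2];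
      congr c; exact: val_inj.
  by exists w; split; [apply: (we 0)|apply: (we 1)].
have [w1 [l1 m1]] := onto 1 0; have [w2 [l2 m2]] := onto 0 1.
have y1 : yt e w1 = 0.
  by have := quad w1; rewrite l1 m1 => h; apply: (addcomb (c := 1) h); ring.
have x2 : xt e w2 = 0.
  by have := quad w2; rewrite l2 m2 => h; apply: (addcomb (c := - 1) h); ring.
exists (xt e w1) => w.
have h := quad w; have h1 := quad (w + w1); have h2 := quad (w + w2).
have h3 := quad (w1 + w2); move: h1 h2 h3; rewrite !apD !xtD !ytD l1 m1 l2 m2 y1 x2.
move=> h1 h2 h3; have {}h3 : yt e w2 = xt e w1.
  by apply: (addcomb (c := 1) h3); ring.
split.
  by apply: (addcomb (c := - 1) h2); apply: (addcomb (c := 1) h); rewrite h3; ring.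
by apply: (addcomb (c := 1) h1); apply: (addcomb (c := - 1) h); ring.
Qed.

Lemma D_eq0 e : D e -> (forall w, xt e w = 0 /\ yt e w = 0) -> e = 0.
Proof.
move=> [le me ne te] z; apply: inj => //.
  by apply: t_indep => w; have [] := z w.
by apply: t_indep => w; have [] := z w.
Qed.

(** If [c] is nonzero, [l] and [m] are combinations of [t3], [t4], [t5], so the common kernel of
    [n], [t3], [t4], [t5] lies in [D]. It has dimension at least 2, hence contains some [e'] not
    proportional to [e]; but [e' - (c' / c) *: e] has factor 0 and vanishes. *)
Lemma D_trivial e : D e -> e = 0.
Proof.
move=> De; have [c ce] := D_proportional De; case: (eqVneq c 0) => [c0|c0].
  by apply: D_eq0 => // w; have [-> ->] := ce w; rewrite c0 !mul0r.
pose g (i : 'I_4) := nth 0 [:: n; t3; t4; t5] i.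
have dimB : (1 < \dim (ker_on g fullv))%N.
  by have h := dim_ker_on g fullv; rewrite dimV in h; rewrite -(leq_add2r 4).
have [e' /ker_onP [_ ge'] ee'] := exists_not_multiple e dimB.
have [ne' t3e' t4e' t5e'] : [/\ ap n e' = 0, ap t3 e' = 0, ap t4 e' = 0 & ap t5 e' = 0].
  have gE j (lj : (j < 4)%N) := ge' (Ordinal lj).
  by split; [apply: (gE 0%N isT)|apply: (gE 1%N isT)|apply: (gE 2%N isT)|apply: (gE 3%N isT)].
have De' : D e'.
  have [xe ye] := ce e'; move: xe ye; rewrite /xt /yt t3e' t4e' t5e' !mulr0 !addr0.
  move=> /esym/eqP; rewrite mulf_eq0 (negPf c0) => /eqP le'.
  by move=> /esym/eqP; rewrite mulf_eq0 (negPf c0) => /eqP me'.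
have [c' ce'] := D_proportional De'.
suff /eqP : e' - (c' / c) *: e = 0.
  by rewrite subr_eq0 => /eqP e'E; case/negP: ee'; rewrite e'E memvZ // memv_line.
have [[le me ne [t3e t4e t5e]] [le' me' _ _]] := (De, De').
rewrite -scaleNr; apply: D_eq0 => [|w].
  by split; [..|split]; rewrite apD apZ ?le ?me ?ne ?t3e ?t4e ?t5e ?le' ?me'
    ?ne' ?t3e' ?t4e' ?t5e' mulr0 addr0.
have [xe ye] := ce w; have [xe' ye'] := ce' w.
split.
  transitivity (xt e' w - c' / c * xt e w); first by rewrite /xt !apD !apZ; ring.
  by rewrite xe xe'; field.
transitivity (yt e' w - c' / c * yt e w); first by rewrite /yt !apD !apZ; ring.
by rewrite ye ye'; field.
Qed.

Lemma coordinates_onto a b c d3 d4 d5 : exists w,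
  [/\ ap l w = a, ap m w = b, ap n w = c & [/\ ap t3 w = d3, ap t4 w = d4 & ap t5 w = d5]].
Proof.
have [w _ gw|w _ we] := ap_row_onto (g := fun i : 'I_6 => nth 0 [:: l; m; n; t3; t4; t5] i)
    dimV _ (fun i => nth 0 [:: a; b; c; d3; d4; d5] i).
  have gE j (lj : (j < 6)%N) := gw (Ordinal lj).
  apply: D_trivial; split; [exact: (gE 0%N isT)|exact: (gE 1%N isT)|exact: (gE 2%N isT)|].
  by split; [exact: (gE 3%N isT)|exact: (gE 4%N isT)|exact: (gE 5%N isT)].
have gE j (lj : (j < 6)%N) := we (Ordinal lj).
exists w; split; [exact: (gE 0%N isT)|exact: (gE 1%N isT)|exact: (gE 2%N isT)|].
by split; [exact: (gE 3%N isT)|exact: (gE 4%N isT)|exact: (gE 5%N isT)].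
Qed.

(* [r], [q], [s] are the shears of the dual basis that remove the entries [x]   *)
(* and [y] of the basis [b1 .. o5] of [V].                                      *)
Record normal_basis r3 r4 r5 q3 q4 q5 s3 s4 s5 (b1 b2 o3 o4 o5 : V) : Prop := {
  nb_b1 : [/\ ap l b1 = 1, ap m b1 = 0, ap n b1 = 0,
    [/\ ap t3 b1 = 0, ap t4 b1 = 0 & ap t5 b1 = 0] &
    [/\ ap x3 b1 = r3, ap x4 b1 = r4 & ap x5 b1 = r5] /\
    [/\ ap y3 b1 = 0, ap y4 b1 = 0 & ap y5 b1 = 0]];
  nb_b2 : [/\ ap l b2 = 0, ap m b2 = 1, ap n b2 = 0,
    [/\ ap t3 b2 = 0, ap t4 b2 = 0 & ap t5 b2 = 0] &
    [/\ ap x3 b2 = 0, ap x4 b2 = 0 & ap x5 b2 = 0] /\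
    [/\ ap y3 b2 = r3, ap y4 b2 = r4 & ap y5 b2 = r5]];
  nb_o3 : [/\ ap l o3 = 0, ap m o3 = 0, ap n o3 = 0,
    [/\ ap t3 o3 = 1, ap t4 o3 = 0 & ap t5 o3 = 0] &
    [/\ ap x3 o3 = 0, ap x4 o3 = - q5 & ap x5 o3 = q4] /\
    [/\ ap y3 o3 = 0, ap y4 o3 = - s5 & ap y5 o3 = s4]];
  nb_o4 : [/\ ap l o4 = 0, ap m o4 = 0, ap n o4 = 0,
    [/\ ap t3 o4 = 0, ap t4 o4 = 1 & ap t5 o4 = 0] &
    [/\ ap x3 o4 = q5, ap x4 o4 = 0 & ap x5 o4 = - q3] /\
    [/\ ap y3 o4 = s5, ap y4 o4 = 0 & ap y5 o4 = - s3]];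
  nb_o5 : [/\ ap l o5 = 0, ap m o5 = 0, ap n o5 = 0,
    [/\ ap t3 o5 = 0, ap t4 o5 = 0 & ap t5 o5 = 1] &
    [/\ ap x3 o5 = - q4, ap x4 o5 = q3 & ap x5 o5 = 0] /\
    [/\ ap y3 o5 = - s4, ap y4 o5 = s3 & ap y5 o5 = 0]] }.

(** Comparing coefficients in [cubic]: on the [o] vectors [x] and [y] are skew 3 x 3 matrices, [y]
    vanishes on [b1], [x] on [b2], and [x] on [b1] equals [y] on [b2]. *)
Lemma exists_normal_basis : exists r3 r4 r5 q3 q4 q5 s3 s4 s5 b1 b2 o3 o4 o5,
  normal_basis r3 r4 r5 q3 q4 q5 s3 s4 s5 b1 b2 o3 o4 o5.
Proof.
have [b1 [lb1 mb1 nb1 [t3b1 t4b1 t5b1]]] := coordinates_onto 1 0 0 0 0 0.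
have [b2 [lb2 mb2 nb2 [t3b2 t4b2 t5b2]]] := coordinates_onto 0 1 0 0 0 0.
have [o3 [lo3 mo3 no3 [t3o3 t4o3 t5o3]]] := coordinates_onto 0 0 0 1 0 0.
have [o4 [lo4 mo4 no4 [t3o4 t4o4 t5o4]]] := coordinates_onto 0 0 0 0 1 0.
have [o5 [lo5 mo5 no5 [t3o5 t4o5 t5o5]]] := coordinates_onto 0 0 0 0 0 1.
have F c1 c2 d3 d4 d5 :
    c2 * (d3 * (c1 * ap x3 b1 + c2 * ap x3 b2 + d3 * ap x3 o3 + d4 * ap x3 o4 + d5 * ap x3 o5)
    + d4 * (c1 * ap x4 b1 + c2 * ap x4 b2 + d3 * ap x4 o3 + d4 * ap x4 o4 + d5 * ap x4 o5)
    + d5 * (c1 * ap x5 b1 + c2 * ap x5 b2 + d3 * ap x5 o3 + d4 * ap x5 o4 + d5 * ap x5 o5))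
  - c1 * (d3 * (c1 * ap y3 b1 + c2 * ap y3 b2 + d3 * ap y3 o3 + d4 * ap y3 o4 + d5 * ap y3 o5)
    + d4 * (c1 * ap y4 b1 + c2 * ap y4 b2 + d3 * ap y4 o3 + d4 * ap y4 o4 + d5 * ap y4 o5)
    + d5 * (c1 * ap y5 b1 + c2 * ap y5 b2 + d3 * ap y5 o3 + d4 * ap y5 o4 + d5 * ap y5 o5))
  = 0.
  rewrite -[RHS](cubic (c1 *: b1 + c2 *: b2 + d3 *: o3 + d4 *: o4 + d5 *: o5)).
  rewrite /xt /yt !apD !apZ lb1 mb1 t3b1 t4b1 t5b1 lb2 mb2 t3b2 t4b2 t5b2.
  by rewrite lo3 mo3 t3o3 t4o3 t5o3 lo4 mo4 t3o4 t4o4 t5o4 lo5 mo5 t3o5 t4o5 t5o5; ring.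
have cancel2 (a : K) : 2 * a = 0 -> a = 0.
  by move/eqP; rewrite mulf_eq0 (negPf two_neq0) => /eqP.
(* Evaluations at opposite arguments separate even from odd terms, at the cost of a factor 2. *)
have y3b1 : ap y3 b1 = 0.
  apply: cancel2; apply: (addcomb (c := 1) (F 1 0 1 0 0)).
  by apply: (addcomb (c := - 1) (F 1 0 (-1) 0 0)); ring.
have y4b1 : ap y4 b1 = 0.
  apply: cancel2; apply: (addcomb (c := 1) (F 1 0 0 1 0)).
  by apply: (addcomb (c := - 1) (F 1 0 0 (-1) 0)); ring.
have y5b1 : ap y5 b1 = 0.
  apply: cancel2; apply: (addcomb (c := 1) (F 1 0 0 0 1)).
  by apply: (addcomb (c := - 1) (F 1 0 0 0 (-1))); ring.
have x3b2 : ap x3 b2 = 0.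
  apply: cancel2; apply: (addcomb (c := - 1) (F 0 1 1 0 0)).
  by apply: (addcomb (c := 1) (F 0 1 (-1) 0 0)); ring.
have x4b2 : ap x4 b2 = 0.
  apply: cancel2; apply: (addcomb (c := - 1) (F 0 1 0 1 0)).
  by apply: (addcomb (c := 1) (F 0 1 0 (-1) 0)); ring.
have x5b2 : ap x5 b2 = 0.
  apply: cancel2; apply: (addcomb (c := - 1) (F 0 1 0 0 1)).
  by apply: (addcomb (c := 1) (F 0 1 0 0 (-1))); ring.
have Fo d3 d4 d5 := conj (F 1 0 d3 d4 d5) (F 0 1 d3 d4 d5).
have [y3o3 x3o3] : ap y3 o3 = 0 /\ ap x3 o3 = 0.
  have [f1 f2] := Fo 1 0 0; split.
    by apply: (addcomb (c := 1) f1); apply: (addcomb (c := 1) y3b1); ring.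
  by apply: (addcomb (c := - 1) f2); apply: (addcomb (c := 1) x3b2); ring.
have [y4o4 x4o4] : ap y4 o4 = 0 /\ ap x4 o4 = 0.
  have [f1 f2] := Fo 0 1 0; split.
    by apply: (addcomb (c := 1) f1); apply: (addcomb (c := 1) y4b1); ring.
  by apply: (addcomb (c := - 1) f2); apply: (addcomb (c := 1) x4b2); ring.
have [y5o5 x5o5] : ap y5 o5 = 0 /\ ap x5 o5 = 0.
  have [f1 f2] := Fo 0 0 1; split.
    by apply: (addcomb (c := 1) f1); apply: (addcomb (c := 1) y5b1); ring.
  by apply: (addcomb (c := - 1) f2); apply: (addcomb (c := 1) x5b2); ring.
have zs := (y3b1, y4b1, y5b1, x3b2, x4b2, x5b2, y3o3, x3o3, y4o4, x4o4, y5o5, x5o5).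
have [y34 x34] : ap y3 o4 = - ap y4 o3 /\ ap x3 o4 = - ap x4 o3.
  have := Fo 1 1 0; rewrite !zs => -[f1 f2]; split.
    by apply: (addcomb (c := 1) f1); ring.
  by apply: (addcomb (c := - 1) f2); ring.
have [y35 x35] : ap y3 o5 = - ap y5 o3 /\ ap x3 o5 = - ap x5 o3.
  have := Fo 1 0 1; rewrite !zs => -[f1 f2]; split.
    by apply: (addcomb (c := 1) f1); ring.
  by apply: (addcomb (c := - 1) f2); ring.
have [y45 x45] : ap y4 o5 = - ap y5 o4 /\ ap x4 o5 = - ap x5 o4.
  have := Fo 0 1 1; rewrite !zs => -[f1 f2]; split.
    by apply: (addcomb (c := 1) f1); ring.
  by apply: (addcomb (c := - 1) f2); ring.
have r3 : ap y3 b2 = ap x3 b1.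
  by have := F 1 1 1 0 0; rewrite !zs => f; apply: (addcomb (c := 1) f); ring.
have r4 : ap y4 b2 = ap x4 b1.
  by have := F 1 1 0 1 0; rewrite !zs => f; apply: (addcomb (c := 1) f); ring.
have r5 : ap y5 b2 = ap x5 b1.
  by have := F 1 1 0 0 1; rewrite !zs => f; apply: (addcomb (c := 1) f); ring.
(* [q] and [s] are the vectors whose cross products give the skew matrices of [x] and [y]. *)
exists (ap x3 b1), (ap x4 b1), (ap x5 b1), (- ap x5 o4), (ap x5 o3), (- ap x4 o3).
exists (- ap y5 o4), (ap y5 o3), (- ap y4 o3), b1, b2, o3, o4, o5.
by split; split; rewrite ?opprK.
Qed.

End CubicRelation.

Section NormalForm.
Variables (K : fieldType) (W V : vectType K).
Hypothesis two_neq0 : 2 != 0 :> K.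
Hypothesis K_closed : GRing.closed_field_axiom K.
Variables (ev : V -> W -> W -> K) (L : V -> W -> dual W) (E : W -> W -> dual V).
Hypothesis apL : forall w u v, ap (L w u) v = ev w u v.
Hypothesis apE : forall w u v, ap (E u v) w = ev w u v.
Hypothesis ev_skew : forall w u v, ev w v u = - ev w u v.
Hypothesis ev_neq0 : forall w, w != 0 -> exists u v, ev w u v != 0.
Hypothesis dimW : \dim {:W} = 6%N.
Hypothesis ev_pf6 : forall w f, pf6 (entries ev w f) = 0.
Hypothesis dimV : \dim {:V} = 6%N.
Hypothesis no_isotropic3 : forall x y z, free [:: x; y; z] ->
  ~ forall w, [/\ ev w x y = 0, ev w x z = 0 & ev w y z = 0].
Hypothesis no_small_orbit : forall u a b c d, free [:: u; a; b; c; d] ->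
  ~ forall w, [/\ ev w u a = 0, ev w u b = 0, ev w u c = 0 & ev w u d = 0].
Implicit Types (w p : V) (u v x y z k l : W).

Let fam_Dr := fam_Dr apL.
Let fam_Zr := fam_Zr apL.
Let fam_Df := fam_Df apE.
Let fam_Zf := fam_Zf apE.
Let fam_Dl := fam_Dl apL ev_skew.
Let fam_Zl := fam_Zl apL ev_skew.
Let fam_diag := fam_diag two_neq0 ev_skew.

Definition is_wedge w (a b : dual W) :=
  forall u v, ev w u v = ap a u * ap b v - ap b u * ap a v.

Lemma dual_pair_ap_eq f d (a b : dual W) : dual_pair 6 f d ->
  (forall i, (i < 6)%N -> ap a (f i) = ap b (f i)) -> forall v, ap a v = ap b v.
Proof.
move=> fd ab v; rewrite (dual_pair_decomp dimW fd v) !ap_sum.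
by apply: eq_bigr => i _; rewrite !apZ ab.
Qed.

Lemma is_wedge_entries w a b f d : dual_pair 6 f d ->
  (forall i j, (i < j)%N -> (j < 6)%N ->
     ev w (f i) (f j) = ap a (f i) * ap b (f j) - ap b (f i) * ap a (f j)) ->
  is_wedge w a b.
Proof.
move=> fd e; have {}e i j : (i < 6)%N -> (j < 6)%N ->
     ev w (f i) (f j) = ap a (f i) * ap b (f j) - ap b (f i) * ap a (f j).
  move=> li lj; case: (ltngtP i j) => ij; first exact: e.
    by rewrite ev_skew e //; ring.
  by rewrite ij fam_diag; ring.
have el j u : (j < 6)%N ->
    ev w u (f j) = ap a u * ap b (f j) - ap b u * ap a (f j).
  move=> lj; rewrite ev_skew -apL.
  have -> : ap (L w (f j)) u = ap (- ap b (f j) *: a + ap a (f j) *: b) u.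
    apply: (dual_pair_ap_eq fd) => i li.
    by rewrite apL ev_skew e // apDf !apZf; ring.
  by rewrite apDf !apZf; ring.
move=> u v; rewrite -apL.
have -> : ap (L w u) v = ap (ap a u *: b + - ap b u *: a) v.
  apply: (dual_pair_ap_eq fd) => j lj.
  by rewrite apL el // apDf !apZf; ring.
by rewrite apDf !apZf; ring.
Qed.

Lemma normal_form : exists f d, dual_pair 6 f d /\
  [/\ exists w, is_wedge w (d 0%N) (d 1%N), exists w, is_wedge w (d 0%N) (d 2%N),
      exists w, is_wedge w (d 1%N) (d 2%N) &
    [/\ exists w, is_wedge w (d 3%N) (d 4%N), exists w, is_wedge w (d 3%N) (d 5%N) &
        exists w, is_wedge w (d 4%N) (d 5%N)]].
Proof.
have [p [u [v p_dec]]] := exists_decomposable two_neq0 K_closed apL apE ev_skew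
  ev_neq0 dimW ev_pf6 dimV.
have [x [y [k [l]]]] := exists_residual_line two_neq0 apL apE ev_skew dimW ev_pf6
  no_isotropic3 p_dec.
case=> fr [[ux vx] [uy vy]] [[uk vk] [ul vl]] res.
have [puv pE] := p_dec.
have [d fd] := free_dual fr; rewrite /= in fd.
pose f := nth 0 [:: u; v; l; x; y; k]; rewrite -/f in fd.
have dd i j li lj := fd i j li lj.
have := (dd^~ 0%N, dd^~ 1%N, dd^~ 2%N, dd^~ 3%N, dd^~ 4%N, dd^~ 5%N).
rewrite /f /= => dE.
(* A nontrivial relation makes [l] orthogonal to [a *: u + b *: v] as well as to [U], hence to a
   hyperplane containing [l]. *)
have lm_indep a b : (forall w, a * ap (E u l) w + b * ap (E v l) w = 0) ->
    a = 0 /\ b = 0.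
  move=> ab0; pose z := a *: u + b *: v.
  have orth w : [/\ ev w l z = 0, ev w l x = 0, ev w l y = 0 & ev w l k = 0].
    have [lx ly lk] := res w; split=> //.
    by have := ab0 w; rewrite !apE (ev_skew w z l) /z fam_Dl !fam_Zl => ->; rewrite oppr0.
  have no_dual c : ~ [/\ ap c l = 0, ap c z = 1, ap c x = 0, ap c y = 0 & ap c k = 0].
    move=> [cl cz cx cy ck]; apply: (@no_small_orbit l z x y k) => //.
    apply: (@dual_pair_free _ _ 5 (nth 0 [:: l; z; x; y; k])
      (nth 0 [:: d 2%N; c; d 3%N; d 4%N; d 5%N])) => i j li lj.
    do 5?[case: i li => [|i] //= li]; do 5?[case: j lj => [|j] //= lj];
    rewrite ?cl ?cz ?cx ?cy ?ck ?dE //;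
    by rewrite /z apD !apZ ?dE //=; ring.
  have [->|a0] := eqVneq a 0; last first.
    case: (no_dual (a^-1 *: d 0%N)); rewrite /z !apZf apD !apZ ?dE //=.
    by split; field.
  have [->|b0] := eqVneq b 0; first by [].
  case: (no_dual (b^-1 *: d 1%N)); rewrite /z !apZf apD !apZ ?dE //=.
  by split; field.
have iso_free z z' c c' : ap c l = 0 -> ap c z = 1 -> ap c z' = 0 ->
    ap c' l = 0 -> ap c' z = 0 -> ap c' z' = 1 -> ap (d 2%N) z = 0 ->
    ap (d 2%N) z' = 0 -> ~ forall w, [/\ ev w l z = 0, ev w l z' = 0 & ev w z z' = 0].
  move=> cl cz cz' c'l c'z c'z' dz dz'; apply: no_isotropic3.
  apply: (@dual_pair_free _ _ 3 (nth 0 [:: l; z; z'])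
    (nth 0 [:: d 2%N; c; c'])) => i j li lj.
  do 3?[case: i li => [|i] //= li]; do 3?[case: j lj => [|j] //= lj];
  by rewrite ?cl ?cz ?cz' ?c'l ?c'z ?c'z' ?dz ?dz' ?dE.
(* A nontrivial relation gives a plane in the span of [x, y, k] isotropic for all forms; with [l] it
   spans an isotropic 3-space. The cases choose a nonzero coefficient to divide by. *)
have t_indep a b c :
    (forall w, a * ap (E y k) w + b * ap (- E x k) w + c * ap (E x y) w = 0) ->
    [/\ a = 0, b = 0 & c = 0].
  move=> abc0; have {}abc0 w : a * ev w y k - b * ev w x k + c * ev w x y = 0.
    by rewrite -[RHS](abc0 w) apNf !apE; ring.
  have [c0|c0] := eqVneq c 0; last first.
    case: (@iso_free (x - (a / c) *: k) (y - (b / c) *: k) (d 3%N) (d 4%N));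
      rewrite -?scaleNr ?apD ?apZ ?dE //=; try by ring.
    move=> w; have [lx ly lk] := res w.
    rewrite !fam_Dr !fam_Dl !fam_Zr !fam_Zl lx ly lk fam_diag !mulr0 !addr0; split=> //.
    by apply: (mulfI c0); rewrite mulr0 -[RHS](abc0 w) (ev_skew w y k); field.
  have [b0|b0] := eqVneq b 0; last first.
    case: (@iso_free (x - (a / b) *: y) k (d 3%N) (d 5%N));
      rewrite -?scaleNr ?apD ?apZ ?dE //=; try by ring.
    move=> w; have [lx ly lk] := res w.
    rewrite !fam_Dr !fam_Dl !fam_Zr !fam_Zl lx ly lk !mulr0 !addr0; split=> //.
    by apply: (mulfI b0); rewrite mulr0 -oppr0 -[in RHS](abc0 w) c0; field.
  have [a0|a0] := eqVneq a 0; first by [].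
  case: (@iso_free y k (d 4%N) (d 5%N)); rewrite ?dE //.
  move=> w; have [lx ly lk] := res w; split=> //; apply: (mulfI a0).
  by rewrite mulr0 -[RHS](abc0 w) b0 c0; ring.
have xl w : ev w x l = 0 by have [h _ _] := res w; rewrite ev_skew h oppr0.
have yl w : ev w y l = 0 by have [_ h _] := res w; rewrite ev_skew h oppr0.
have kl w : ev w k l = 0 by have [_ _ h] := res w; rewrite ev_skew h oppr0.
have lx w : ev w l x = 0 by have [h _ _] := res w.
have ly w : ev w l y = 0 by have [_ h _] := res w.
have lk w : ev w l k = 0 by have [_ _ h] := res w.
have inj w : ap (E u l) w = 0 -> ap (E v l) w = 0 -> ap (E u v) w = 0 ->
  [/\ ap (E u x) w = 0, ap (E u y) w = 0 & ap (E u k) w = 0] ->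
  [/\ ap (E v x) w = 0, ap (E v y) w = 0 & ap (E v k) w = 0] ->
  [/\ ap (E y k) w = 0, ap (- E x k) w = 0 & ap (E x y) w = 0] -> w = 0.
  rewrite apNf !apE => z1 z2 z3 [z4 z5 z6] [z7 z8 z9] [z10 /eqP z11 z12].
  move: z11; rewrite oppr_eq0 => /eqP z11.
  apply/eqP; apply: contrapT => /negP /ev_neq0 [u' [v' /eqP]]; apply.
  suff /(_ u' v') -> : is_wedge w 0 0 by rewrite !ap0f mulr0 subrr.
  apply: is_wedge_entries fd _ => i j ij lj; rewrite !ap0f mulr0 subrr.
  by do 6?[case: j lj ij => [|j] //= lj ij]; do 5?[case: i ij => [|i] //= ij].
(* In the basis [f] the Pfaffian of [w] reduces to this cubic. *)
have cubic w : ap (E v l) w * (ap (E u x) w * ap (E y k) w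
     + ap (E u y) w * ap (- E x k) w + ap (E u k) w * ap (E x y) w)
   - ap (E u l) w * (ap (E v x) w * ap (E y k) w
     + ap (E v y) w * ap (- E x k) w + ap (E v k) w * ap (E x y) w) = 0.
  rewrite !apNf !apE -[RHS](ev_pf6 w f) /pf6 /entries /f /= lx ly lk; ring.
have [r3 [r4 [r5 [q3 [q4 [q5 [s3 [s4 [s5 [b1 [b2 [o3 [o4 [o5 nb]]]]]]]]]]]]]] :=
  exists_normal_basis two_neq0 cubic lm_indep t_indep inj dimV.
case: nb; rewrite !apNf !apE.
move=> [b1l b1m b1n [b1t3 /eqP b1t4 b1t5] [[b1x3 b1x4 b1x5] [b1y3 b1y4 b1y5]]].
move=> [b2l b2m b2n [b2t3 /eqP b2t4 b2t5] [[b2x3 b2x4 b2x5] [b2y3 b2y4 b2y5]]].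
move=> [o3l o3m o3n [o3t3 /eqP o3t4 o3t5] [[o3x3 o3x4 o3x5] [o3y3 o3y4 o3y5]]].
move=> [o4l o4m o4n [o4t3 o4t4 o4t5] [[o4x3 o4x4 o4x5] [o4y3 o4y4 o4y5]]].
move=> [o5l o5m o5n [o5t3 /eqP o5t4 o5t5] [[o5x3 o5x4 o5x5] [o5y3 o5y4 o5y5]]].
move: b1t4 b2t4 o3t4 o5t4; rewrite !oppr_eq0 => /eqP b1t4 /eqP b2t4 /eqP o3t4 /eqP o5t4.
have {}o4t4 : ev o4 x k = -1 by rewrite -o4t4 opprK.
(* The shears absorb the mixed terms: [b1] becomes the wedge of [d' 0] and [d' 2], and [o5] that of
   [d' 3] and [d' 4] up to a multiple of [p]. [f'] is dual to [d']. *)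
pose d' := nth 0 [:: d 0%N; d 1%N; d 2%N + r3 *: d 3%N + r4 *: d 4%N + r5 *: d 5%N;
  d 3%N + q3 *: d 0%N + s3 *: d 1%N; d 4%N + q4 *: d 0%N + s4 *: d 1%N;
  d 5%N + q5 *: d 0%N + s5 *: d 1%N].
pose f' := nth 0 [::
  u + (- q3) *: x + (- q4) *: y + (- q5) *: k + (q3 * r3 + q4 * r4 + q5 * r5) *: l;
  v + (- s3) *: x + (- s4) *: y + (- s5) *: k + (s3 * r3 + s4 * r4 + s5 * r5) *: l;
  l; x + (- r3) *: l; y + (- r4) *: l; k + (- r5) *: l].
exists f', d'; split.
  move=> i j li lj; rewrite /f' /d'.
  do 6?[case: i li => [|i] //= li]; do 6?[case: j lj => [|j] //= lj];
  rewrite ?(apDf, apZf) ?(apD, apZ) ?(apDf, apZf) ?dE //=; ring.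
have pz a b : ev p u a = 0 -> ev p v a = 0 -> ev p a b = 0.
  by move=> ea eb; rewrite pE ea eb mul0r mulr0 subr0.
have pxy := pz x y ux vx; have pxk := pz x k ux vx; have pyk := pz y k uy vy.
split.
- exists p; apply: is_wedge_entries fd _ => i j ij lj.
  do 6?[case: j lj ij => [|j] //= lj ij]; do 5?[case: i ij => [|i] //= ij];
  rewrite ?dE //= ?puv ?ux ?vx ?uy ?vy ?uk ?vk ?ul ?vl ?lx ?ly ?lk ?pxy ?pxk ?pyk; ring.
- exists b1; apply: is_wedge_entries fd _ => i j ij lj.
  do 6?[case: j lj ij => [|j] //= lj ij]; do 5?[case: i ij => [|i] //= ij];
  rewrite ?(apDf, apZf) ?dE //= ?lx ?ly ?lk ?b1l ?b1m ?b1n ?b1t3 ?b1t4 ?b1t5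
    ?b1x3 ?b1x4 ?b1x5 ?b1y3 ?b1y4 ?b1y5; ring.
- exists b2; apply: is_wedge_entries fd _ => i j ij lj.
  do 6?[case: j lj ij => [|j] //= lj ij]; do 5?[case: i ij => [|i] //= ij];
  rewrite ?(apDf, apZf) ?dE //= ?lx ?ly ?lk ?b2l ?b2m ?b2n ?b2t3 ?b2t4 ?b2t5
    ?b2x3 ?b2x4 ?b2x5 ?b2y3 ?b2y4 ?b2y5; ring.
have pe := (puv, ux, vx, uy, vy, uk, vk, ul, vl, pxy, pxk, pyk).
split.
(* The multiple of [p] is the coefficient of the wedge of [d 0] and [d 1] in that of [d' 3] and
   [d' 4]. In the next case the sign of [o4] compensates for the coordinate [- E x k]. *)
- exists (o5 + (q3 * s4 - s3 * q4) *: p); apply: is_wedge_entries fd _ => i j ij lj.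
  do 6?[case: j lj ij => [|j] //= lj ij]; do 5?[case: i ij => [|i] //= ij];
  rewrite !fam_Df !fam_Zf ?pe ?(apDf, apZf) ?dE //= ?lx ?ly ?lk ?o5l ?o5m ?o5n
    ?o5t3 ?o5t4 ?o5t5 ?o5x3 ?o5x4 ?o5x5 ?o5y3 ?o5y4 ?o5y5; ring.
- exists (-1 *: o4 + (q3 * s5 - s3 * q5) *: p); apply: is_wedge_entries fd _ => i j ij lj.
  do 6?[case: j lj ij => [|j] //= lj ij]; do 5?[case: i ij => [|i] //= ij];
  rewrite !fam_Df !fam_Zf ?pe ?(apDf, apZf) ?dE //= ?lx ?ly ?lk ?o4l ?o4m ?o4n
    ?o4t3 ?o4t4 ?o4t5 ?o4x3 ?o4x4 ?o4x5 ?o4y3 ?o4y4 ?o4y5; ring.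
- exists (o3 + (q4 * s5 - s4 * q5) *: p); apply: is_wedge_entries fd _ => i j ij lj.
  do 6?[case: j lj ij => [|j] //= lj ij]; do 5?[case: i ij => [|i] //= ij];
  rewrite !fam_Df !fam_Zf ?pe ?(apDf, apZf) ?dE //= ?lx ?ly ?lk ?o3l ?o3m ?o3n
    ?o3t3 ?o3t4 ?o3t5 ?o3x3 ?o3x4 ?o3x5 ?o3y3 ?o3y4 ?o3y5; ring.
Qed.

End NormalForm.

(** * Limits of one-parameter subgroups *)

Section ZariskiLimit.
Variables (K : fieldType) (U : vectType K).
Hypothesis char0 : forall n, n.+1%:R != 0 :> K.

Lemma natr_inj_char0 : injective (fun n => n%:R : K).
Proof.
suff lt m n : (m < n)%N -> m%:R != n%:R :> K.
  move=> m n /eqP mn; case: (ltngtP m n) => // [/lt|/lt]; rewrite ?mn //.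
  by rewrite eq_sym mn.
move=> mn; rewrite -(subnKC mn) addSnnS natrD -[X in X == _]addr0.
by rewrite (inj_eq (addrI _)) eq_sym char0.
Qed.

(** The integers from 1 to [size q] are distinct roots, too many for a nonzero [q]. *)
Lemma poly_eq0_char0 (q : {poly K}) : (forall t, t != 0 -> q.[t] = 0) -> q = 0.
Proof.
move=> q0; apply/eqP; apply: contrapT => /negP qn0.
have := @max_poly_roots _ q [seq n.+1%:R | n <- iota 0 (size q)] qn0.
rewrite size_map size_iota ltnn => h; apply: notF (h _ _).
  by apply/allP => _ /mapP [n _ ->]; rewrite rootE q0 ?char0.
by rewrite map_inj_uniq ?iota_uniq // => m n /natr_inj_char0 [].
Qed.

(* A polynomial vanishing along the curve for all [t != 0] vanishes at [t = 0]. *)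
Lemma zariski_closed_limit (X : set U) (I : finType) (d : I -> nat) (y : I -> U) :
  zariski_closed X -> (forall t : K, t != 0 -> X (\sum_i t ^+ d i *: y i)) ->
  X (\sum_i 0 ^+ d i *: y i).
Proof.
case=> S -> inX p Sp.
pose c (i : 'I_(\dim {:U})) : {poly K} :=
  \sum_j coord (vbasis {:U}) i (y j) *: 'X^(d j).
pose q : {poly K} := \sum_(m <- msupp p) p@_m *: \prod_i c i ^+ m i.
have qE t : q.[t] = p.@[fun i => coord (vbasis {:U}) i (\sum_j t ^+ d j *: y j)].
  rewrite mevalE horner_sum; apply: eq_bigr => m _.
  rewrite hornerZ horner_prod; congr (_ * _); apply: eq_bigr => i _.
  rewrite horner_exp; congr (_ ^+ _); rewrite horner_sum linear_sum.
  by apply: eq_bigr => j _; rewrite hornerZ hornerXn linearZ mulrC.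
suff q0 : q = 0 by rewrite -qE q0 horner0.
by apply: poly_eq0_char0 => t t0; rewrite qE; apply: inX.
Qed.

End ZariskiLimit.

(** * The special linear group, its action and diagonal maps *)

Section SpecialLinear.
Variables (K : fieldType) (W : vectType K).
Implicit Types (g h : 'End(W)) (w : bilform W).

Lemma lfun_det_comp g h : lfun_det (g \o h)%VF = lfun_det g * lfun_det h.
Proof.
by rewrite /lfun_det (passmx.mxof_comp _ _ (vbasisP _)) det_mulmx mulrC.
Qed.

Lemma lfun_det1 : lfun_det (\1 : 'End(W)) = 1.
Proof. by rewrite /lfun_det passmx.mxof1 ?det1 // (basis_free (vbasisP _)). Qed.

Lemma lfun_det_ker0 g : lfun_det g != 0 -> lker g == 0%VS.
Proof.
move=> dg; rewrite -subv0; apply/subvP => v; rewrite memv_ker memv0 => /eqP gv.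
have e := vbasisP {:W}.
rewrite -(passmx.rVof_eq0 e); apply/eqP.
have : passmx.rVof (vbasis {:W}) (g v) = 0.
  by apply/eqP; rewrite gv (passmx.rVof_eq0 e).
rewrite (passmx.rVof_app _ e).
move=> /(congr1 (fun r => r *m invmx (passmx.mxof (vbasis {:W}) (vbasis {:W}) g))).
by rewrite /= mulmxK ?mul0mx // unitmxE unitfE.
Qed.

Lemma lfun_inv_eq g h : (h \o g = \1)%VF -> g^-1%VF = h.
Proof.
move=> hg; have g0 : lker g == 0%VS.
  apply/lker0P => u v /(congr1 h).
  by rewrite -!comp_lfunE hg !id_lfunE.
by rewrite -[LHS]comp_lfun1l -hg -comp_lfunA lker0_compfV // comp_lfun1r.
Qed.

Lemma SL_ker0 g : SL g -> lker g == 0%VS.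
Proof. by move=> g1; apply: lfun_det_ker0; rewrite g1 oner_eq0. Qed.

Lemma SL_comp g h : SL g -> SL h -> SL (g \o h)%VF.
Proof. by move=> g1 h1; rewrite /SL /= lfun_det_comp g1 h1 mulr1. Qed.

Lemma SL_inv g : SL g -> SL (g^-1)%VF.
Proof.
move=> g1; have := congr1 (@lfun_det _ _) (lker0_compVf (SL_ker0 g1)).
by rewrite lfun_det_comp g1 mulr1 lfun_det1.
Qed.

Lemma act_comp g h w : lker g == 0%VS -> lker h == 0%VS ->
  act (g \o h)%VF w = act g (act h w).
Proof.
move=> g0 h0; apply/lfunP => u; apply/lfunP => v; rewrite !actE.
have -> : (g \o h)^-1%VF = (h^-1 \o g^-1)%VF.
  by apply: lfun_inv_eq; rewrite -comp_lfunA (comp_lfunA g^-1) lker0_compVf //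
    comp_lfun1l lker0_compVf.
by rewrite !comp_lfunE.
Qed.

Lemma act1 w : act \1%VF w = w.
Proof.
apply/lfunP => u; apply/lfunP => v; rewrite actE (@lfun_inv_eq _ \1) ?comp_lfun1l //.
by rewrite !id_lfunE.
Qed.

Section Diagonal.
Variables (f : nat -> W) (x : nat -> dual W).
Local Notation n := (\dim {:W}).
Hypothesis fx : dual_pair n f x.
Implicit Types c d : nat -> K.

Definition diag_fun c v := \sum_(i < n) (c i * ap (x i) v) *: f i.

Lemma diag_fun_is_linear c : linear (diag_fun c).
Proof.
move=> a u v; rewrite /diag_fun scaler_sumr -big_split /=; apply: eq_bigr => i _.
by rewrite apD apZ scalerA -scalerDl; congr (_ *: _); ring.
Qed.

HB.instance Definition _ c :=
  GRing.isLinear.Build K W W _ (diag_fun c) (diag_fun_is_linear c).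

Definition diag c : 'End(W) := linfun (diag_fun c).

Lemma diagE c (j : 'I_n) : diag c (f j) = c j *: f j.
Proof.
rewrite lfunE /= /diag_fun (bigD1 j) //= fx // eqxx mulr1 big1 ?addr0 // => i ij.
by rewrite fx // (negPf (ij : (i : nat) != j)) mulr0 scale0r.
Qed.

Lemma dual_pair_lfunP g h : (forall j : 'I_n, g (f j) = h (f j)) -> g = h.
Proof.
move=> gh; apply/lfunP => v; rewrite (dual_pair_decomp erefl fx v) !linear_sum.
by apply: eq_bigr => j _; rewrite !linearZ /= gh.
Qed.

Lemma diag_comp c d : (diag c \o diag d)%VF = diag (fun i => c i * d i).
Proof.
by apply: dual_pair_lfunP => j; rewrite comp_lfunE !diagE linearZ /= diagE scalerA mulrC.
Qed.

Lemma diag1 : diag (fun=> 1) = \1%VF.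
Proof. by apply: dual_pair_lfunP => j; rewrite diagE id_lfunE scale1r. Qed.

Lemma diag_inv c d : (forall i, c i * d i = 1) -> (diag c)^-1%VF = diag d.
Proof.
move=> cd; apply: lfun_inv_eq; rewrite diag_comp -diag1; apply: dual_pair_lfunP => j.
by rewrite !diagE mulrC cd.
Qed.

(** The two base changes between [vbasis] and [f] have inverse determinants, so the determinant can
    be computed in [f]. *)
Lemma lfun_det_diag c : lfun_det (diag c) = \prod_(i < n) c i.
Proof.
pose t := [tuple f i | i < n].
have tf (i : 'I_n) : t`_i = f i by rewrite -tnth_nth tnth_mktuple.
have te : basis_of {:W} t.
  rewrite basisEfree subvf size_tuple leqnn andbT.
  by rewrite (_ : tval t = mkseq f n) ?(dual_pair_free fx) // /mkseq -val_enum_ord -map_comp.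
have e := vbasisP {:W}.
have detV : \det (passmx.mxof (vbasis {:W}) t \1) * \det (passmx.mxof t (vbasis {:W}) \1) = 1.
  by rewrite -det_mulmx -(passmx.mxof_comp _ _ te) comp_lfun1l passmx.mxof1 ?det1 ?(basis_free e).
rewrite /lfun_det -[diag c]comp_lfun1l -[diag c]comp_lfun1r.
rewrite (passmx.mxof_comp _ _ te) (passmx.mxof_comp _ _ te) !det_mulmx mulrAC detV mul1r.
have -> : passmx.mxof t t (diag c) = diag_mx (\row_i c i).
  apply/row_matrixP => i; rewrite rowE passmx.mul_mxof passmx.vecof_delta tf diagE -tf.
  apply/rowP => j; rewrite !mxE linearZ /= coord_free ?(basis_free te) //.
  by rewrite mulr_natr.
by rewrite det_diag; apply: eq_bigr => i _; rewrite mxE.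
Qed.

End Diagonal.

End SpecialLinear.

(** * Destabilizing one-parameter subgroups *)

Section HilbertMumford.
Variables (K : fieldType) (W : vectType K).
Hypothesis char0 : forall n, n.+1%:R != 0 :> K.
Implicit Types (a b : dual W) (w T : bilform W) (u v : W).

Definition tensor_fun a b u : dual W := ap a u *: b.

Lemma tensor_fun_is_linear a b : linear (tensor_fun a b).
Proof. by move=> c u v; rewrite /tensor_fun apD apZ scalerDl scalerA. Qed.

HB.instance Definition _ a b :=
  GRing.isLinear.Build K W (dual W) _ (tensor_fun a b) (tensor_fun_is_linear a b).

Definition tensor a b : bilform W := linfun (tensor_fun a b).

Lemma ev_tensor a b u v : ev (tensor a b) u v = ap a u * ap b v.
Proof. by rewrite /ev lfunE /= /tensor_fun scale_lfunE. Qed.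

Definition coef_fun u v T w : bilform W := ev w u v *: T.

Lemma coef_fun_is_linear u v T : linear (coef_fun u v T).
Proof. by move=> c w1 w2; rewrite /coef_fun evDf evZf scalerDl scalerA. Qed.

HB.instance Definition _ u v T := GRing.isLinear.Build K (bilform W) (bilform W) _
  (coef_fun u v T) (coef_fun_is_linear u v T).

Definition coef u v T : 'End(bilform W) := linfun (coef_fun u v T).

Lemma ev_coef u v T w u' v' : ev (coef u v T w) u' v' = ev w u v * ev T u' v'.
Proof. by rewrite -evZf; congr (ev _ _ _); apply: lfunE. Qed.

Lemma linfun_actE g w : linfun (act g) w = act g w.
Proof. exact: lfunE. Qed.

Lemma ev_act g w u v : ev (act g w) u v = ev w (g^-1%VF u) (g^-1%VF v).
Proof. exact: actE. Qed.

Variables (f : nat -> W) (x : nat -> dual W).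
Local Notation n := (\dim {:W}).
Hypothesis fx : dual_pair n f x.
Variable m : nat -> nat.
Hypothesis sum_m : (\sum_(i < n) m i = n)%N.

(** The weights on the dual basis are [m i - 1], shifted by 1 to keep exponents natural; [sum_m]
    says that they add up to 0. The entry (i, j) of a form has weight [m i + m j - 2]. *)
Definition one_ps (t : K) : 'End(W) := diag f x (fun i => t / t ^+ m i).

Lemma SL_one_ps t : t != 0 -> SL (one_ps t).
Proof.
move=> t0; rewrite /SL /= /one_ps lfun_det_diag // prodf_div -expr_sum sum_m.
by rewrite prodr_const card_ord divff // expf_neq0.
Qed.

Lemma ev_one_ps t w (i j : 'I_n) : t != 0 ->
  ev (act (one_ps t) w) (f i) (f j) = t ^+ m i / t * (t ^+ m j / t) * ev w (f i) (f j).
Proof.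
move=> t0; rewrite ev_act /one_ps (@diag_inv _ _ _ _ fx _ (fun i => t ^+ m i / t)).
  by rewrite !diagE // evZl evZr mulrA.
by move=> k; have := expf_neq0 (m k) t0; move: t0 => t0 tk; field; rewrite t0.
Qed.

(* The curve [t |-> one_ps t * phi] extends to [t = 0] because all the        *)
(* coefficients of negative weight vanish; its value there lies in the closed *)
(* orbit and is fixed by the one-parameter subgroup.                          *)
Lemma one_ps_orbit (V : vectType K) (phi : 'Hom(V, bilform W)) i0 :
  (i0 < n)%N -> m i0 = 2 ->
  (forall r i j, (i < n)%N -> (j < n)%N -> (m i + m j < 2)%N ->
     ev (phi r) (f i) (f j) = 0) ->
  zariski_closed (SL_orbit phi) -> ~ finite_set (SL_stabilizer phi).
Proof.
move=> li0 mi0 phi0 closed_orbit fin_stab.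
(* Truncated subtraction turns negative weights into 0; the entries concerned vanish by [phi0]. *)
pose d (ij : 'I_n * 'I_n) := (m ij.1 + m ij.2 - 2)%N.
pose y (ij : 'I_n * 'I_n) : 'Hom(V, bilform W) :=
  (coef (f ij.1) (f ij.2) (tensor (x ij.1) (x ij.2)) \o phi)%VF.
have yE t r (k l : 'I_n) : ev ((\sum_ij t ^+ d ij *: y ij) r) (f k) (f l) =
    t ^+ (m k + m l - 2) * ev (phi r) (f k) (f l).
  rewrite sum_lfunE ev_sumf (bigD1 (k, l)) //= big1 => [|[i j] ne].
    rewrite addr0 scale_lfunE evZf comp_lfunE ev_coef ev_tensor.
    by rewrite !fx // !eqxx !mulr1.
  rewrite scale_lfunE evZf comp_lfunE ev_coef ev_tensor !fx //.
  rewrite -natrM mulnb (_ : _ && _ = false) ?mulr0 //.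
  by apply: contraNF ne => /andP [/eqP ik /eqP jl]; apply/eqP; congr pair; apply: val_inj.
have curve t : t != 0 -> SL_orbit phi (\sum_ij t ^+ d ij *: y ij).
  move=> t0; exists (one_ps t); first exact: SL_one_ps.
  apply/lfunP => r; apply: (dual_pair_bilformP erefl fx) => i j li lj.
  rewrite (yE t r (Ordinal li) (Ordinal lj)) comp_lfunE linfun_actE.
  rewrite (ev_one_ps _ (Ordinal li) (Ordinal lj)) //=.
  have [le2|lt2] := leqP 2 (m i + m j); last first.
    by rewrite phi0 // !mulr0.
  congr (_ * _); rewrite mulf_div -exprD -expr2 -[in RHS](subnK le2) exprD.
  by rewrite mulfK ?expf_neq0.
have [g g1 limE] := zariski_closed_limit char0 closed_orbit curve.
set psi := \sum_ij _ in limE.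
have fixed s : s != 0 -> (linfun (act (one_ps s)) \o psi)%VF = psi.
  move=> s0; apply/lfunP => r; apply: (dual_pair_bilformP erefl fx) => i j li lj.
  rewrite comp_lfunE linfun_actE (ev_one_ps _ (Ordinal li) (Ordinal lj)) //=.
  rewrite (yE 0 r (Ordinal li) (Ordinal lj)) /=.
  have [lt2|gt2|eq2] := ltngtP (m i + m j) 2.
  - by rewrite phi0 // !mulr0.
  - by rewrite expr0n subn_eq0 leqNgt gt2 /= mul0r !mulr0.
  by rewrite mulf_div -exprD eq2 divff ?mul1r // mulf_neq0.
have g0 := SL_ker0 g1.
(* The limit [psi] is the translate of [phi] by [g], so conjugation by [g] moves the stabilizer of
   [psi] to that of [phi]. *)
pose k s := (g^-1 \o (one_ps s \o g))%VF.
have stab_k s : s != 0 -> SL_stabilizer phi (k s).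
  move=> s0; have h1 := SL_one_ps s0; split.
    by apply: SL_comp; [apply: SL_inv|apply: SL_comp].
  apply/lfunP => r; rewrite comp_lfunE linfun_actE /k.
  rewrite /= act_comp ?SL_ker0 //; [|exact: SL_inv|exact: SL_comp].
  rewrite act_comp ?SL_ker0 //.
  have psiE : act g (phi r) = psi r by rewrite limE comp_lfunE linfun_actE.
  have -> : act (one_ps s) (act g (phi r)) = psi r.
    by rewrite psiE -[in RHS](fixed s s0) comp_lfunE linfun_actE.
  by rewrite -psiE -act_comp ?lker0_compVf ?act1 // SL_ker0 //; apply: SL_inv.
(* As [m i0 = 2], the eigenvalue of [one_ps s] at [f i0] is the inverse of [s], which recovers
   [s]. *)
have k_inj s t : s != 0 -> t != 0 -> k s = k t -> s = t.
  move=> s0 t0 /(congr1 (fun h => (g \o h \o g^-1)%VF)).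
  rewrite /k !comp_lfunA lker0_compfV // !comp_lfun1l !lker0_compfK // => st.
  have := congr1 (fun h : 'End(W) => ap (x i0) (h (f i0))) st.
  rewrite /one_ps !(diagE fx _ (Ordinal li0)) /= !apZ fx // eqxx !mulr1 mi0 => e.
  apply: invr_inj; transitivity (s / s ^+ 2); first by field.
  by rewrite e; field.
apply: infinite_nat; rewrite -(@eq_finite_set _ _ (range (fun i => k i.+1%:R))).
  by apply: sub_finite_set fin_stab => _ [i _ <-]; apply: stab_k.
apply: inj_card_eq => i j _ _ /k_inj e.
by have /(natr_inj_char0 char0) [] := e (char0 i) (char0 j).
Qed.

Lemma one_ps_not_stable (A : {vspace bilform W}) i0 :
  (i0 < n)%N -> m i0 = 2 ->
  (forall w, w \in A -> forall i j, (i < n)%N -> (j < n)%N -> (m i + m j < 2)%N ->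
     ev w (f i) (f j) = 0) ->
  ~ stable A.
Proof.
move=> li0 mi0 A0 [phi [_ imphi closed_orbit fin_stab]].
apply: (one_ps_orbit li0 mi0 _ closed_orbit fin_stab) => r; apply: A0.
by have := memv_img phi (memvf r); rewrite imphi.
Qed.

End HilbertMumford.

Section StableSystems.
Variables (K : fieldType) (W : vectType K).
Hypothesis char0 : forall n, n.+1%:R != 0 :> K.
Hypothesis dimW : \dim {:W} = 6%N.
Variable A : {vspace bilform W}.
Hypothesis A_stable : stable A.
Hypothesis A_skew : forall w, w \in A -> skew w.

Lemma stable_no_isotropic3 (x y z : W) : free [:: x; y; z] ->
  ~ forall w, w \in A -> [/\ ev w x y = 0, ev w x z = 0 & ev w y z = 0].
Proof.
have two_neq0 := char0 1; move=> /free_extend [s bs] iso.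
have sz : size s = 3.
  by have := eqP (basis_free bs); rewrite (span_basis bs) dimW => -[].
case: s sz bs => [|a [|b [|c []]]] //= _ bs.
have [d fd] := free_dual (basis_free bs); rewrite /= -dimW in fd.
(* The entries of negative weight are those with both arguments among [x, y, z]. *)
apply: (one_ps_not_stable char0 fd (m := nth 0%N [:: 0; 0; 0; 2; 2; 2]%N) _ (i0 := 3)) A_stable.
- by rewrite dimW !big_ord_recr big_ord0.
- by rewrite dimW.
- by [].
move=> w Aw; have [xy xz yz] := iso w Aw; have sk := A_skew Aw; rewrite dimW.
have [yx zx zy] : [/\ ev w y x = 0, ev w z x = 0 & ev w z y = 0].
  by split; rewrite (skewP sk) ?xy ?xz ?yz oppr0.
by case=> [|[|[|[|[|[|]]]]]] // [|[|[|[|[|[|]]]]]] //= _ _ _; apply: skew_diag.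
Qed.

Lemma stable_no_small_orbit (u a b c d : W) : free [:: u; a; b; c; d] ->
  ~ forall w, w \in A -> [/\ ev w u a = 0, ev w u b = 0, ev w u c = 0 & ev w u d = 0].
Proof.
have two_neq0 := char0 1; move=> /free_extend [s bs] orb.
have sz : size s = 1.
  by have := eqP (basis_free bs); rewrite (span_basis bs) dimW => -[].
case: s sz bs => [|e []] //= _ bs.
have [g fg] := free_dual (basis_free bs); rewrite /= -dimW in fg.
(* The entries of negative weight pair [u] with itself or with one of [a, b, c, d]. *)
apply: (one_ps_not_stable char0 fg (m := nth 0%N [:: 0; 1; 1; 1; 1; 2]%N) _ (i0 := 5)) A_stable.
- by rewrite dimW !big_ord_recr big_ord0.
- by rewrite dimW.
- by [].
move=> w Aw; have [ua ub uc ud] := orb w Aw; have sk := A_skew Aw; rewrite dimW.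
have [au bu cu du] : [/\ ev w a u = 0, ev w b u = 0, ev w c u = 0 & ev w d u = 0].
  by split; rewrite (skewP sk) ?ua ?ub ?uc ?ud oppr0.
by case=> [|[|[|[|[|[|]]]]]] // [|[|[|[|[|[|]]]]]] //= _ _ _; apply: skew_diag.
Qed.

End StableSystems.

(** * Transport by the special linear group *)

Section StandardSpan.
Variables (K : fieldType) (W : vectType K).
Implicit Types (a b : dual W) (w : bilform W) (f : nat -> W) (d : nat -> dual W).

(** Since [s] spans all functionals, only 0 is killed by [s]; evaluation on [s] is then bijective,
    and [f] consists of the preimages of the unit vectors. *)
Lemma dual_basis_dual_pair (s : seq (dual W)) :
  basis_of {:dual W} s -> size s = \dim {:W} ->
  exists f, dual_pair (size s) f (nth 0 s).
Proof.
move=> bs sz.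
have sep v : (forall i : 'I_(size s), ap s`_i v = 0) -> v = 0.
  move=> sv.
  have av a : ap a v = 0.
    have : a \in <<in_tuple s>>%VS by rewrite (span_basis bs) memvf.
    move/coord_span => ->; rewrite ap_sumf big1 // => i _.
    by rewrite apZf sv mulr0.
  have [d] := free_dual (basis_free (vbasisP {:W})); rewrite size_tuple => vd.
  by rewrite (dual_pair_decomp erefl vd v) big1 // => i _; rewrite av scale0r.
have onto (j : nat) : exists v, forall i, (i < size s)%N -> ap s`_i v = (i == j)%:R.
  have [v _ vj] := ap_row_onto (g := fun i : 'I_(size s) => s`_i) (A := fullv)
    (esym sz) (fun v _ => @sep v) (fun i => (i == j :> nat)%:R).
  by exists v => i li; apply: (vj (Ordinal li)).
have [f fE] := choice onto.
by exists f => i j li _; apply: fE.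
Qed.

Definition wedges d : seq (bilform W) :=
  [:: wedge (d 0%N) (d 1%N); wedge (d 0%N) (d 2%N); wedge (d 1%N) (d 2%N);
      wedge (d 3%N) (d 4%N); wedge (d 3%N) (d 5%N); wedge (d 4%N) (d 5%N)].

Definition ev_fun (u v : W) w : K^o := ev w u v.

Lemma ev_fun_is_linear u v : linear (ev_fun u v).
Proof. by move=> c w1 w2; rewrite /ev_fun evDf evZf. Qed.

HB.instance Definition _ u v :=
  GRing.isLinear.Build K (bilform W) K^o _ (ev_fun u v) (ev_fun_is_linear u v).

Definition ev_at u v : dual (bilform W) := linfun (ev_fun u v).

Lemma ap_ev_at u v w : ap (ev_at u v) w = ev w u v.
Proof. by rewrite /ap lfunE. Qed.

Lemma free_wedges f d : dual_pair 6 f d -> free (wedges d).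
Proof.
move=> fd; pose E i j := ev_at (f i) (f j).
apply: (@dual_pair_free _ _ 6 (nth 0 (wedges d)) (nth 0 [:: E 0%N 1%N; E 0%N 2%N;
  E 1%N 2%N; E 3%N 4%N; E 3%N 5%N; E 4%N 5%N])) => i j li lj.
do 6?[case: i li => [|i] //= li]; do 6?[case: j lj => [|j] //= lj];
by rewrite ap_ev_at ev_wedge !fd //= ?(mulr0, mul0r, mulr1, subr0).
Qed.

End StandardSpan.

Section Transport.
Variables (K : fieldType) (W : vectType K).
Hypothesis K_closed : GRing.closed_field_axiom K.
Variables (f f' : nat -> W) (d d' : nat -> dual W).
Local Notation n := (\dim {:W}).
Hypothesis n_gt0 : (0 < n)%N.
Hypothesis fd : dual_pair n f d.
Hypothesis fd' : dual_pair n f' d'.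

Lemma diag_sumE (h : nat -> W) (x : nat -> dual W) c v :
  diag h x c v = \sum_(i < n) (c i * ap (x i) v) *: h i.
Proof. by rewrite /diag lfunE. Qed.

Lemma ap_diag (h : nat -> W) (y x : nat -> dual W) c v (i : 'I_n) : dual_pair n h y ->
  ap (y i) (diag h x c v) = c i * ap (x i) v.
Proof.
by move=> hy; rewrite diag_sumE (dual_pair_sum (fun k => c k * ap (x k) v) i hy).
Qed.

Let g0 := diag f' d (fun=> 1).

Lemma lfun_det_basis_change : lfun_det g0 != 0.
Proof.
have h0 : (diag f d' (fun=> 1) \o g0)%VF = \1%VF.
  apply: (dual_pair_lfunP fd) => j; rewrite comp_lfunE id_lfunE diag_sumE.
  rewrite [RHS](dual_pair_decomp erefl fd); apply: eq_bigr => i _.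
  by rewrite (ap_diag _ _ _ _ fd') !mul1r.
have := congr1 (@lfun_det _ _) h0; rewrite lfun_det_comp lfun_det1 => e.
by apply/eqP => g00; move/eqP: e; rewrite g00 mulr0 eq_sym oner_eq0.
Qed.

(** The base change from [f] to [f'] is rescaled by an [n]-th root of its inverse determinant. All
    wedges acquire the same factor, so spans are unaffected. *)
Lemma exists_transport : exists2 g, SL g & exists2 c, c != 0 &
  forall i j : 'I_n, act g (wedge (d i) (d j)) = c *: wedge (d' i) (d' j).
Proof.
have [c cE] := K_closed (nth 0 [:: (lfun_det g0)^-1]) n_gt0.
have {}cE : c ^+ n = (lfun_det g0)^-1.
  rewrite cE; case: (n) n_gt0 => // k _; rewrite big_ord_recl big1 ?addr0 ?mulr1 // => i _.
  by rewrite /= nth_nil mul0r.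
have c0 : c != 0.
  apply/eqP => c0; move/eqP: cE; rewrite c0 expr0n eqn0Ngt n_gt0 /=.
  by rewrite eq_sym invr_eq0 (negPf lfun_det_basis_change).
pose g := (diag f' d' (fun=> c) \o g0)%VF.
have gE v (i : 'I_n) : ap (d' i) (g v) = c * ap (d i) v.
  by rewrite comp_lfunE !(ap_diag _ _ _ _ fd') mul1r.
have gV : g^-1%VF = diag f d' (fun=> c^-1).
  apply: lfun_inv_eq; apply: (dual_pair_lfunP fd) => j.
  rewrite comp_lfunE id_lfunE diag_sumE [RHS](dual_pair_decomp erefl fd).
  by apply: eq_bigr => i _; rewrite gE mulKf.
have dV (i : 'I_n) v : ap (d i) (g^-1%VF v) = c^-1 * ap (d' i) v.
  by rewrite gV (ap_diag _ _ _ _ fd).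
exists g.
  rewrite /SL /= lfun_det_comp lfun_det_diag // prodr_const card_ord cE.
  by rewrite mulVf // lfun_det_basis_change.
exists (c^-1 * c^-1) => [|i j]; first by rewrite mulf_neq0 ?invr_eq0.
apply: bilformP => u v; rewrite ev_act evZf !ev_wedge !dV; ring.
Qed.

End Transport.

Section TransportSpans.
Variables (K : fieldType) (W : vectType K).
Hypothesis K_closed : GRing.closed_field_axiom K.
Hypothesis dimW : \dim {:W} = 6%N.

Lemma SL_equiv_wedges f d f' d' : dual_pair (W := W) 6 f d -> dual_pair 6 f' d' ->
  SL_equiv <<wedges d>>%VS <<wedges d'>>%VS.
Proof.
move=> fd fd'; have fd6 := fd; have fd6' := fd'; rewrite -dimW in fd6 fd6'.
have n0 : (0 < \dim {:W})%N by rewrite dimW.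
have [g g1 [c c0 gE]] := exists_transport K_closed n0 fd6 fd6'; exists g => //.
have {}gE i j : (i < 6)%N -> (j < 6)%N ->
    act g (wedge (d i) (d j)) = c *: wedge (d' i) (d' j).
  by rewrite -dimW => li lj; apply: (gE (Ordinal li) (Ordinal lj)).
apply/eqP; rewrite eqEdim; apply/andP; split.
  have mem i j : (i < 6)%N -> (j < 6)%N -> wedge (d i) (d j) \in wedges d ->
      wedge (d' i) (d' j) \in (linfun (act g) @: <<wedges d>>)%VS.
    move=> li lj dij; rewrite -[wedge _ _](scalerK c0) -gE // -linfun_actE.
    by rewrite memvZ // memv_img // memv_span.
  apply/span_subvP => w; rewrite !inE.
  by do 5?[case/orP]; move/eqP ->; apply: mem; rewrite // !inE eqxx ?orbT.
rewrite (eqP (free_wedges fd')) -[size _]/(size (wedges d)) -(eqP (free_wedges fd)).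
rewrite -(limg_ker_dim (linfun (act g)) <<wedges d>>%VS).
exact: leq_addl.
Qed.

End TransportSpans.

(** * The two planes *)

Section Planes.
Variables (K : fieldType) (W : vectType K).
Hypothesis two_neq0 : 2 != 0 :> K.
Implicit Types (a b c : dual W) (w : bilform W).

Lemma memv_span3 (V : vectType K) (x y z v : V) : v \in <<[:: x; y; z]>>%VS ->
  exists r s t, v = r *: x + s *: y + t *: z.
Proof.
move=> /(coord_span (X := [tuple x; y; z])); rewrite !big_ord_recr big_ord0 /= add0r => ->.
by do 3!eexists.
Qed.

(** Every 2-form in three variables is decomposable; the explicit factorization divides by [r]
    unless [r = 0]. *)
Lemma span3_wedge a b c w : w \in <<[:: wedge a b; wedge a c; wedge b c]>>%VS ->
  exists a' b', w = wedge a' b'.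
Proof.
move=> /memv_span3 [r [s [t ->]]]; have [->|r0] := eqVneq r 0.
  exists (s *: a + t *: b), c; apply: bilformP => u v.
  by rewrite !(evDf, evZf, ev_wedge, apDf, apZf); ring.
exists (a - (t / r) *: c), (r *: b + s *: c); apply: bilformP => u v.
by rewrite !(evDf, evZf, ev_wedge, apDf, apZf, apNf); field.
Qed.

Lemma span3_rank a b c w : w \in <<[:: wedge a b; wedge a c; wedge b c]>>%VS ->
  w != 0 -> skew w /\ form_rank w = 2%N.
Proof.
move=> /span3_wedge [a' [b' ->]] w0; split; first exact: skew_wedge.
exact: rank_wedge.
Qed.

Variables (f : nat -> W) (d : nat -> dual W).
Hypothesis fd : dual_pair 6 f d.

Definition plane1 := <<[:: wedge (d 0%N) (d 1%N); wedge (d 0%N) (d 2%N); wedge (d 1%N) (d 2%N)]>>%VS.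
Definition plane2 := <<[:: wedge (d 3%N) (d 4%N); wedge (d 3%N) (d 5%N); wedge (d 4%N) (d 5%N)]>>%VS.

Lemma dim_planes : [/\ \dim plane1 = 3, \dim plane2 = 3 & (plane1 :&: plane2 = 0)%VS].
Proof.
have := free_wedges fd.
rewrite -[wedges d]/([:: _; _; _] ++ [:: _; _; _]) cat_free => /and3P [f1 f2 dir].
by split; [exact: (eqP f1)|exact: (eqP f2)|exact/directv_addP].
Qed.

Lemma span_wedges : <<wedges d>>%VS = (plane1 + plane2)%VS.
Proof. by rewrite -[wedges d]/([:: _; _; _] ++ [:: _; _; _]) span_cat. Qed.

(** The Pfaffians of [w] on two indices from each triple are the products of a coordinate of [p]
    with one of [q]. Rank 2 makes them all vanish, so [p] or [q] is 0. *)
Lemma rank2_planes w : skew w -> form_rank w = 2%N -> w \in <<wedges d>>%VS ->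
  w \in plane1 \/ w \in plane2.
Proof.
move=> sk rk; rewrite span_wedges => /memv_addP [p pP [q qQ wE]].
have [p0 [p1 [p2 pE]]] := memv_span3 pP; have [q0 [q1 [q2 qE]]] := memv_span3 qQ.
have pf g : pf4 (gram w g) = 0 by apply: rank_pf4; rewrite ?rk.
have we i j : (i < 6)%N -> (j < 6)%N -> ev w (f i) (f j) =
    p0 * ((0%N == i)%:R * (1%N == j)%:R - (1%N == i)%:R * (0%N == j)%:R) +
    p1 * ((0%N == i)%:R * (2%N == j)%:R - (2%N == i)%:R * (0%N == j)%:R) +
    p2 * ((1%N == i)%:R * (2%N == j)%:R - (2%N == i)%:R * (1%N == j)%:R) +
    (q0 * ((3%N == i)%:R * (4%N == j)%:R - (4%N == i)%:R * (3%N == j)%:R) +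
    q1 * ((3%N == i)%:R * (5%N == j)%:R - (5%N == i)%:R * (3%N == j)%:R) +
    q2 * ((4%N == i)%:R * (5%N == j)%:R - (5%N == i)%:R * (4%N == j)%:R)).
  by move=> li lj; rewrite wE pE qE !(evDf, evZf) !ev_wedge !fd.
have pq : [/\ p0 * q0 = 0, p0 * q1 = 0, p0 * q2 = 0 &
    [/\ p1 * q0 = 0, p1 * q1 = 0 & p1 * q2 = 0] /\
    [/\ p2 * q0 = 0, p2 * q1 = 0 & p2 * q2 = 0]].
  have pf' i j k l : (i < 6)%N -> (j < 6)%N -> (k < 6)%N -> (l < 6)%N ->
      ev w (f i) (f j) * ev w (f k) (f l) - ev w (f i) (f k) * ev w (f j) (f l)
      + ev w (f i) (f l) * ev w (f j) (f k) = 0.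
    by move=> li lj lk ll; have := pf (nth 0 [:: f i; f j; f k; f l]).
  split; [have := pf' 0 1 3 4 isT isT isT isT | have := pf' 0 1 3 5 isT isT isT isT
    | have := pf' 0 1 4 5 isT isT isT isT | split; split];
  [ .. | have := pf' 0 2 3 4 isT isT isT isT | have := pf' 0 2 3 5 isT isT isT isT
    | have := pf' 0 2 4 5 isT isT isT isT | have := pf' 1 2 3 4 isT isT isT isT
    | have := pf' 1 2 3 5 isT isT isT isT | have := pf' 1 2 4 5 isT isT isT isT ];
  by rewrite !we //= => e0; apply: (addcomb (c := - 1) e0); ring.
have cancel (x y : K) : x * y = 0 -> y != 0 -> x = 0.
  by move=> /eqP; rewrite mulf_eq0 => /orP [/eqP // | ->].
have right_if (y : K) : p0 * y = 0 -> p1 * y = 0 -> p2 * y = 0 -> y != 0 -> w \in plane2.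
  move=> h0 h1 h2 y0; rewrite wE pE (cancel _ _ h0 y0) (cancel _ _ h1 y0) (cancel _ _ h2 y0).
  by rewrite !scale0r !addr0 add0r.
case: pq => p0q0 p0q1 p0q2 [[p1q0 p1q1 p1q2] [p2q0 p2q1 p2q2]].
have [q00|q00] := eqVneq q0 0; last by right; apply: right_if q00.
have [q10|q10] := eqVneq q1 0; last by right; apply: right_if q10.
have [q20|q20] := eqVneq q2 0; last by right; apply: right_if q20.
by left; rewrite wE qE q00 q10 q20 !scale0r !addr0.
Qed.

End Planes.

(** * The space of the statement *)

Section Target.
Variables (K : fieldType) (W : vectType K).
Hypothesis two_neq0 : 2 != 0 :> K.
Hypothesis dimW : \dim {:W} = 6%N.

(* With [x = e1 + e5] and [y = e2 - e4] one has                               *)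
(* [2 (e1 /\ e4 + e2 /\ e5) = (e1 - e5) /\ (e2 + e4) - x /\ y], and similarly *)
(* for the second and the third form.                                         *)
Lemma target_wedges (e1 e2 e3 e4 e5 e6 : dual W) :
  basis_of {:dual W} [:: e1; e2; e3; e4; e5; e6] ->
  exists f d, dual_pair (W := W) 6 f d /\
    <<[:: wedge e1 e4 + wedge e2 e5; wedge e1 e6 + wedge e3 e5; wedge e2 e6 - wedge e3 e4;
          wedge (e1 - e5) (e2 + e4); wedge (e1 - e5) (e3 + e6);
          wedge (e2 + e4) (e3 + e6)]%R>>%VS = <<wedges d>>%VS.
Proof.
move=> be; have [f fe] := dual_basis_dual_pair be (esym dimW); rewrite /= in fe.
pose d := nth 0 [:: e1 - e5; e2 + e4; e3 + e6; e1 + e5; e2 - e4; e3 - e6].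
pose h := 2^-1 : K.
pose f' := nth 0 [:: h *: (f 0%N + -1 *: f 4%N); h *: (f 1%N + f 3%N); h *: (f 2%N + f 5%N);
  h *: (f 0%N + f 4%N); h *: (f 1%N + -1 *: f 3%N); h *: (f 2%N + -1 *: f 5%N)].
have fd : dual_pair 6 f' d.
  have fE i j li lj := fe i j li lj.
  have := (fE 0%N, fE 1%N, fE 2%N, fE 3%N, fE 4%N, fE 5%N); rewrite /= => {}fE i j li lj.
  do 6?[case: i li => [|i] //= li]; do 6?[case: j lj => [|j] //= lj];
  by rewrite /d /f' /= ?(apDf, apNf) !(apZ, apD) !fE //= /h; field.
exists f', d; split => //; apply/esym/eqP.
set T := [:: _ + _; _; _; _; _; _].
(* [T] has six elements and the six wedges are free, so it remains to find the wedges in the span of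
   [T]. *)
rewrite eqEdim (eqP (free_wedges fd)) (dim_span T : is_true (_ <= 6)%N) andbT.
have T_mem i : (i < 6)%N -> T`_i \in <<T>>%VS by move=> li; rewrite memv_span // mem_nth.
apply/span_subvP => w; rewrite !inE.
have wE : [/\ wedge (d 3%N) (d 4%N) = T`_3 - 2 *: T`_0,
  wedge (d 3%N) (d 5%N) = T`_4 - 2 *: T`_1 &
  wedge (d 4%N) (d 5%N) = T`_5 - 2 *: T`_2].
  by split; apply: bilformP => u v; rewrite /T /d /=;
    rewrite !(evDf, evNf, evZf, ev_wedge, apDf, apNf); ring.
case: wE => E3 E4 E5.
do 5?[case/orP]; move/eqP ->;
  rewrite -?[wedge (d 0%N) (d 1%N)]/T`_3 -?[wedge (d 0%N) (d 2%N)]/T`_4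
    -?[wedge (d 1%N) (d 2%N)]/T`_5 ?E3 ?E4 ?E5 ?memvB ?memvZ ?T_mem //.
Qed.

End Target.

(** * Classification *)

Section PfaffianSystems.
Variables (K : fieldType) (W : vectType K).
Hypothesis char0 : forall n, n.+1%:R != 0 :> K.
Hypothesis K_closed : GRing.closed_field_axiom K.
Hypothesis dimW : \dim {:W} = 6%N.
Variable A : {vspace bilform W}.
Hypothesis dimA : \dim A = 6%N.
Hypothesis A_Pf : forall w, w \in A -> w != 0 -> in_Pf w.
Hypothesis A_stable : stable A.

Lemma Pf_skew w : w \in A -> skew w.
Proof.
move=> Aw; have [->|w0] := eqVneq w 0; first exact: skew0.
by case: (A_Pf Aw w0).
Qed.

Lemma Pf_pf6 w f : w \in A -> pf6 (gram w f) = 0.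
Proof.
move=> Aw; have [->|w0] := eqVneq w 0.
  by rewrite /pf6 /gram !ev0f; ring.
have [_ sk rk] := A_Pf Aw w0; apply: (rank_pf6 (char0 1)) => //.
exact: leq_ltn_trans rk _.
Qed.

(** [normal_form] is applied to [subvs_of A], the vector space underlying [A]. It puts six
    independent wedges in [A], which exhaust it by dimension. *)
Lemma stable_Pf_wedges : exists f d, dual_pair (W := W) 6 f d /\ A = <<wedges d>>%VS.
Proof.
have two_neq0 := char0 1.
pose sev (w : subvs_of A) := ev (vsval w).
have skw w := Pf_skew (subvsP w).
have [f [d [fd nf]]] : exists f d, dual_pair (W := W) 6 f d /\
  [/\ exists w, is_wedge sev w (d 0%N) (d 1%N), exists w, is_wedge sev w (d 0%N) (d 2%N),
      exists w, is_wedge sev w (d 1%N) (d 2%N) &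
    [/\ exists w, is_wedge sev w (d 3%N) (d 4%N), exists w, is_wedge sev w (d 3%N) (d 5%N) &
        exists w, is_wedge sev w (d 4%N) (d 5%N)]].
  apply: (@normal_form K W (subvs_of A) two_neq0 K_closed sev
    (fun w u => (vsval w : bilform W) u)
    (fun u v => (ev_at u v \o linfun (vsval : subvs_of A -> bilform W))%VF)) => //.
  - by move=> w u v; rewrite /ap comp_lfunE; apply: etrans (ap_ev_at _ _ _) _; rewrite lfunE.
  - by move=> w u v; apply: skewP.
  - by move=> w w0; apply: bilform_neq0; apply: contraNneq w0 => e; apply/eqP/subvs_inj.
  - by move=> w f; apply: Pf_pf6; apply: subvsP.
  - by rewrite dimvf.
  - move=> x y z fr iso; apply: (stable_no_isotropic3 char0 dimW A_stable Pf_skew fr).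
    by move=> w Aw; have := iso (Subvs Aw).
  - move=> u a b c d fr orb.
    apply: (stable_no_small_orbit char0 dimW A_stable Pf_skew fr).
    by move=> w Aw; have := orb (Subvs Aw).
exists f, d; split=> //; apply/esym/eqP.
rewrite eqEdim dimA (eqP (free_wedges fd)) leqnn andbT.
have mem a b : (exists w, is_wedge sev w a b) -> wedge a b \in A.
  move=> [w wE]; rewrite (_ : wedge a b = vsval w) ?subvsP //.
  by apply: bilformP => u v; rewrite ev_wedge -wE.
case: nf => /mem m01 /mem m02 /mem m12 [/mem m34 /mem m35 /mem m45].
by apply/span_subvP => w; rewrite !inE; do 5?[case/orP]; move/eqP ->.
Qed.

Lemma stable_Pf_classification (e1 e2 e3 e4 e5 e6 : dual W) :
  basis_of {:dual W} [:: e1; e2; e3; e4; e5; e6] ->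
  SL_equiv A
    <<[:: wedge e1 e4 + wedge e2 e5; wedge e1 e6 + wedge e3 e5; wedge e2 e6 - wedge e3 e4;
          wedge (e1 - e5) (e2 + e4); wedge (e1 - e5) (e3 + e6);
          wedge (e2 + e4) (e3 + e6)]%R>>%VS
  /\ exists P Q : {vspace bilform W},
       [/\ \dim P = 2.+1, \dim Q = 2.+1, (P :&: Q)%VS = 0%VS &
           forall w : bilform W, w != 0 ->
             (w \in A /\ in_Gr w) <-> (w \in P \/ w \in Q)].
Proof.
have two_neq0 := char0 1.
move=> be; have [f' [d' [fd' ->]]] := target_wedges two_neq0 dimW be.
have [f [d [fd AE]]] := stable_Pf_wedges; split.
  by rewrite AE; apply: SL_equiv_wedges fd fd'.
exists (plane1 d), (plane2 d); have [dim1 dim2 cap] := dim_planes fd; split=> //.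
move=> w w0; split.
  move=> [Aw [_ sk rk]]; apply: (rank2_planes two_neq0 fd sk rk).
  by rewrite -AE.
rewrite AE span_wedges; case=> wP; have [sk rk] := span3_rank two_neq0 wP w0.
  by split; [apply: subvP (addvSl _ _) _ wP|].
by split; [apply: subvP (addvSr _ _) _ wP|].
Qed.

End PfaffianSystems.

Theorem theorem1p3 (R : realType) (W : vectType R[i])
    (dimW : \dim {:W} = 6%N)
    (e1 e2 e3 e4 e5 e6 : dual W)
    (e_basis : basis_of {:dual W} [:: e1; e2; e3; e4; e5; e6])
    (A : {vspace bilform W})
    (dimA : \dim A = 5.+1)
    (A_Pf : forall w : bilform W, w \in A -> w != 0 -> in_Pf w)
    (A_stable : stable A) :
  SL_equiv A
    <<[:: wedge e1 e4 + wedge e2 e5;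
          wedge e1 e6 + wedge e3 e5;
          wedge e2 e6 - wedge e3 e4;
          wedge (e1 - e5) (e2 + e4);
          wedge (e1 - e5) (e3 + e6);
          wedge (e2 + e4) (e3 + e6)]%R>>%VS
  /\ exists P Q : {vspace bilform W},
       [/\ \dim P = 2.+1, \dim Q = 2.+1, (P :&: Q)%VS = 0%VS &
           forall w : bilform W, w != 0 ->
             (w \in A /\ in_Gr w) <-> (w \in P \/ w \in Q)].
Proof.
apply: stable_Pf_classification => //.
- by move=> n; rewrite pnatr_eq0.
- exact: solve_monicpoly.
Qed.
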